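(* There exist a degree bound $d\in\mathbb{N}$ and a finite relational signature $\sigma$ such that there is a first-order $\sigma$-sentence $\varphi$ in $\Pi_2$ for which the property $\{\mathcal{A}\in\mathcal{C}_{\sigma,d}\mid\mathcal{A}\models\varphi\}$ is not testable in the bounded-degree model for relational structures.
   Context: A $\sigma$-structure $\mathcal{A}$ consists of a finite universe $A$ and relations $R^{\mathcal{A}}\subseteq A^{\mathrm{ar}(R)}$ for $R\in\sigma$. The degree of an element is the number of tuples (over all relations) containing it; $\mathcal{C}_{\sigma,d}$ is the class of all $\sigma$-structures of degree at most $d$. A property is a subset of $\mathcal{C}_{\sigma,d}$ closed under isomorphism; $\mathcal{P}_n$ denotes its members with $n$ elements. For $\mathcal{A}$ with $n$ elements, $\mathrm{dist}(\mathcal{A},\mathcal{P}):=\min_{\mathcal{B}\in\mathcal{P}_n}\sum_{R\in\sigma}|R^{\mathcal{A}}\triangle R^{\mathcal{B}}|/(dn)$ (with $\mathcal{B}$ on the same universe); $\mathcal{A}$ is $\epsilon$-far from $\mathcal{P}$ if this exceeds $\epsilon$. An algorithm receives $n$ and oracle access to $\mathcal{A}$ (elements numbered $1,\dots,n$): a query $(a,i)$, $i\le d$, returns the $i$-th tuple containing $a$ together with its relation. An $\epsilon$-tester for $\mathcal{P}_n$ accepts every $\mathcal{A}\in\mathcal{P}_n$ with probability $\ge 2/3$ and rejects every $\mathcal{A}$ that is $\epsilon$-far from $\mathcal{P}_n$ with probability $\ge2/3$. $\mathcal{P}$ is testable if for every $n$ and $\epsilon\in(0,1)$ there is an $\epsilon$-tester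 for $\mathcal{P}_n$ making at most $q(\epsilon,d)$ queries, independent of $n$. $\Pi_2$ is the set of first-order formulas equivalent to one of the form $\forall x_1\dots\forall x_k\exists y_1\dots\exists y_\ell\,\psi$ with $\psi$ quantifier-free. *)

(* Defs.v *)
From HB Require Import structures.
From mathcomp Require Import all_boot all_order all_algebra.
From mathcomp Require Import constructive_ereal reals.

Set Implicit Arguments.
Unset Strict Implicit.
Unset Printing Implicit Defensive.

Import Order.TTheory GRing.Theory Num.Theory.

(* Arities are positive: a nullary relation would contribute to no degree and
   could never be seen through the oracle below. *)
Record signature : Type := Signature {
  symbol :> finType;
  ar : symbol -> nat;
  ar_gt0 : forall r, 0 < ar r
}.

Section Structures.
Variable sigma : signature.

Definition structure (T : finType) : finType :=
  {dffun forall r : sigma, {set (ar r).-tuple T}}.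

(* A tuple together with its relation symbol. *)
Definition fact (T : finType) : finType := {r : sigma & (ar r).-tuple T}.

Definition incident (T : finType) (A : structure T) (a : T) : {set fact T} :=
  [set f : fact T | (tagged f \in A (tag f)) && (a \in tagged f)].

Definition degree (T : finType) (A : structure T) (a : T) : nat :=
  #|incident A a|.

(* Membership in C_{sigma,d}. *)
Definition degree_le (d : nat) (T : finType) (A : structure T) : bool :=
  [forall a, degree A a <= d].

(* [formula n] has its free variables among n de Bruijn indices; a quantifier
   binds index 0. *)
Inductive formula : nat -> Type :=
| Bot n : formula n
| Eq n (i j : 'I_n) : formula n
| Rel n (r : sigma) (args : (ar r).-tuple 'I_n) : formula n
| Not n (f : formula n) : formula n
| And n (f g : formula n) : formula n
| Or n (f g : formula n) : formula n
| All n (f : formula n.+1) : formula n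
| Ex n (f : formula n.+1) : formula n.

Definition sentence : Type := formula 0.

Fixpoint sat (T : finType) (A : structure T) n (f : formula n) :
    n.-tuple T -> bool :=
  match f in formula n return n.-tuple T -> bool with
  | Bot _ => fun _ => false
  | Eq _ i j => fun v => tnth v i == tnth v j
  | Rel _ r args => fun v => map_tuple (tnth v) args \in A r
  | Not _ f => fun v => ~~ sat A f v
  | And _ f g => fun v => sat A f v && sat A g v
  | Or _ f g => fun v => sat A f v || sat A g v
  | All _ f => fun v => [forall x, sat A f (cons_tuple x v)]
  | Ex _ f => fun v => [exists x, sat A f (cons_tuple x v)]
  end.

Definition models (T : finType) (A : structure T) (f : sentence) : bool :=
  sat A f [tuple].

Fixpoint quantifier_free n (f : formula n) : bool :=
  match f with
  | Bot _ | Eq _ _ _ | Rel _ _ _ => true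
  | Not _ f => quantifier_free f
  | And _ f g | Or _ f g => quantifier_free f && quantifier_free g
  | All _ _ | Ex _ _ => false
  end.

Fixpoint All_block k n : formula (k + n) -> formula n :=
  match k return formula (k + n) -> formula n with
  | 0 => fun f => f
  | k'.+1 => fun f => All_block (All f)
  end.

Fixpoint Ex_block k n : formula (k + n) -> formula n :=
  match k return formula (k + n) -> formula n with
  | 0 => fun f => f
  | k'.+1 => fun f => Ex_block (Ex f)
  end.

Definition equivalent n (f g : formula n) : Prop :=
  forall (T : finType) (A : structure T) (v : n.-tuple T),
    sat A f v = sat A g v.

Definition Pi2 n (f : formula n) : Prop :=
  exists (k l : nat) (psi : formula (l + (k + n))),
    quantifier_free psi /\ equivalent f (All_block (Ex_block psi)).

Definition isomorphism (T U : finType) (A : structure T) (B : structure U)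
    (h : T -> U) : Prop :=
  bijective h /\ forall r t, (t \in A r) = (map_tuple h t \in B r).

(* [P n] is the set P_n, with universe {0, ..., n-1}. *)
Record property (d : nat) : Type := Property {
  members :> forall n : nat, pred (structure 'I_n);
  members_degree : forall n (A : structure 'I_n), members A -> degree_le d A;
  members_iso : forall n (A B : structure 'I_n) (h : 'I_n -> 'I_n),
    isomorphism A B h -> members A -> members B
}.

Lemma isomorphism_sat (T U : finType) (A : structure T) (B : structure U) h :
  isomorphism A B h ->
  forall n (f : formula n) (v : n.-tuple T),
    sat A f v = sat B f (map_tuple h v).
Proof.
move=> [bij_h isoAB] n f; have inj_h := bij_inj bij_h.
case: bij_h => h' hK h'K.
have consE m (x : T) (v : m.-tuple T) :
  map_tuple h (cons_tuple x v) = cons_tuple (h x) (map_tuple h v).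
  exact: val_inj.
elim: n / f => //= [n i j|n r args|n f IH|n f IHf g IHg|n f IHf g IHg
                   |n f IH|n f IH] v.
- by rewrite !tnth_map (inj_eq inj_h).
- have argsE : map_tuple h (map_tuple (tnth v) args) =
    map_tuple (tnth (map_tuple h v)) args.
    by apply: eq_from_tnth => i; rewrite !tnth_map.
  by rewrite isoAB argsE.
- by rewrite IH.
- by rewrite IHf IHg.
- by rewrite IHf IHg.
- apply/forallP/forallP => H x; last by rewrite IH consE.
  by have := H (h' x); rewrite IH consE h'K.
- apply/existsP/existsP => -[x]; first by rewrite IH consE; exists (h x).
  by rewrite -{1}[x]h'K -consE -IH; exists (h' x).
Qed.

Lemma isomorphism_degree (T U : finType) (A : structure T) (B : structure U)
    h a :
  isomorphism A B h -> degree A a = degree B (h a).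
Proof.
move=> [bij_h isoAB]; have inj_h := bij_inj bij_h.
case: bij_h => h' hK h'K.
pose H (f : fact T) : fact U :=
  Tagged (fun r => (ar r).-tuple U) (map_tuple h (tagged f)).
pose H' (f : fact U) : fact T :=
  Tagged (fun r => (ar r).-tuple T) (map_tuple h' (tagged f)).
have HK : cancel H H'.
  case=> r t; congr existT; apply: val_inj => /=.
  by rewrite -map_comp map_id_in // => x _; apply: hK.
have H'K : cancel H' H.
  case=> r t; congr existT; apply: val_inj => /=.
  by rewrite -map_comp map_id_in // => x _; apply: h'K.
rewrite /degree -(card_imset _ (can_inj HK)); apply: eq_card => f.
rewrite -[f]H'K mem_imset; last exact: can_inj HK.
by rewrite !inE isoAB /= mem_map.
Qed.

Lemma isomorphism_degree_le d (T U : finType) (A : structure T)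
    (B : structure U) h :
  isomorphism A B h -> degree_le d A -> degree_le d B.
Proof.
move=> isoAB /forallP degA; apply/forallP => b.
have [[h' _ h'K] _] := isoAB.
by rewrite -[b]h'K -(isomorphism_degree _ isoAB).
Qed.

Lemma model_property_degree d (f : sentence) n (A : structure 'I_n) :
  degree_le d A && models A f -> degree_le d A.
Proof. by case/andP. Qed.

Lemma model_property_iso d (f : sentence) n (A B : structure 'I_n)
    (h : 'I_n -> 'I_n) :
  isomorphism A B h ->
  degree_le d A && models A f -> degree_le d B && models B f.
Proof.
move=> isoAB /andP[degA]; rewrite /models (isomorphism_sat isoAB) => satA.
rewrite (isomorphism_degree_le isoAB degA) /=.
by rewrite -(tuple0 (map_tuple h [tuple])).
Qed.

Definition model_property (d : nat) (f : sentence) : property d :=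
  Property (members := fun n A => degree_le d A && models A f)
    (@model_property_degree d f) (@model_property_iso d f).

End Structures.

Local Open Scope ring_scope.

Section Testing.
Variables (R : realType) (sigma : signature) (d : nat).

Definition sym_diff_card n (A B : structure sigma 'I_n) : nat :=
  (\sum_(r : sigma) #|(A r :\: B r) :|: (B r :\: A r)|)%N.

(* The value is +oo when P_n is empty. *)
Definition dist (P : property sigma d) n (A : structure sigma 'I_n) : \bar R :=
  \big[Order.min/+oo%E]_(B : structure sigma 'I_n | P n B)
    ((sym_diff_card A B)%:R / (d * n)%:R)%:E.

Definition far (P : property sigma d) (eps : R) n (A : structure sigma 'I_n) :
    bool :=
  (eps%:E < dist P A)%E.

(* Randomized adaptive algorithms for inputs with n elements; [Flip p] takes
   its first branch with probability p. *)
Inductive algorithm (n : nat) : Type :=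
| Output (accept : bool)
| Flip (p : R) (p01 : 0 <= p <= 1) (t u : algorithm n)
| Query (a : 'I_n) (i : 'I_d)
    (next : option (fact sigma 'I_n) -> algorithm n).

Definition oracle (n : nat) : Type :=
  'I_n -> 'I_d -> option (fact sigma 'I_n).

(* The tuples containing a given element are listed in an arbitrary order;
   queries past the end of the list are answered by None. *)
Definition oracle_for n (A : structure sigma 'I_n) (ans : oracle n) : Prop :=
  exists L : 'I_n -> seq (fact sigma 'I_n),
    (forall a, perm_eq (L a) (enum (incident A a))) /\
    (forall a (i : 'I_d), ans a i = onth (L a) i).

Fixpoint output_prob n (ans : oracle n) (b : bool) (t : algorithm n) : R :=
  match t with
  | Output c => (c == b)%:R
  | Flip p _ t u => p * output_prob ans b t + (1 - p) * output_prob ans b u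
  | Query a i next => output_prob ans b (next (ans a i))
  end.

(* Worst case over the coin flips. *)
Fixpoint num_queries n (ans : oracle n) (t : algorithm n) : nat :=
  match t with
  | Output _ => 0
  | Flip _ _ t u => maxn (num_queries ans t) (num_queries ans u)
  | Query a i next => (num_queries ans (next (ans a i))).+1
  end.

Definition is_tester (P : property sigma d) (eps : R) n (t : algorithm n) :
    Prop :=
  forall (A : structure sigma 'I_n) (ans : oracle n),
    degree_le d A -> oracle_for A ans ->
    (P n A -> 2 / 3 <= output_prob ans true t) /\
    (far P eps A -> 2 / 3 <= output_prob ans false t).

Definition queries_le (q : nat) n (t : algorithm n) : Prop :=
  forall (A : structure sigma 'I_n) (ans : oracle n),
    degree_le d A -> oracle_for A ans -> (num_queries ans t <= q)%N.

Definition testable (P : property sigma d) : Prop :=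
  exists q : R -> nat, forall (n : nat) (eps : R), 0 < eps < 1 ->
    exists t : algorithm n, is_tester P eps t /\ queries_le (q eps) t.

End Testing.

(* Main.v *)
Require Import Defs.
From mathcomp Require Import all_boot all_order all_algebra all_fingroup.
From mathcomp Require Import boolp constructive_ereal reals.
From mathcomp Require Import ring lra zify.

(* The models of the sentence are the finite sets with actions of three
   Heisenberg groups over F_p glued along their root subgroups A, B, C of order
   p (A, B generate the first one, B, C the second, C, A the third), i.e. the
   finite G-sets for the resulting amalgam G.  In each Heisenberg group the
   averages over the two root subgroups commute up to O(p^(-1/2)), so for large
   p every almost invariant function on a finite G-set is close to an invariant
   one (Kazhdan's property (T)).

   G has arbitrarily large finite quotients, coming from SL_3 over
   F_p[t] / (t^N - 1), hence for given q there are quotients Q0 and Q1 with the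
   same balls of radius q and with Q1 as large as desired.  Compare k disjoint
   copies of Q0, a model, with Q1 restricted to k |Q0| < |Q1| points, where k is
   as large as possible.  After random relabelling, q queries tell them apart
   with small probability only.  But the second structure is far from every
   model B: if B were close, then the diagonal of Q1 x B would be almost
   invariant, and a nearby invariant function would give an injection of Q1 into
   the smaller set B. *)

(** The constant of the spectral gap depends neither on the quotient nor on the set acted on. This
    is why p is fixed once, and with it the sentence and the degree, while only the quotients vary
    with q.

    The obstacle is that a tester is told n, so model and non-model need the same number of
    elements, whereas the sizes of Q0 and Q1 are unrelated. The copies and the truncation reconcile
    them: n < |Q1| <= n + |Q0|. The upper bound keeps the number of removed points bounded while n
    grows, so few queries come near the cut. The strict lower bound is the contradiction in the
    farness proof, where Q1 would have to be injected into n points.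

    All clauses of the sentence except totality are universal and survive the truncation. The second
    structure thus violates only the existential part, and at a bounded number of points; the gap
    shows that no small global change repairs it. *)

Set Implicit Arguments.
Unset Strict Implicit.
Unset Printing Implicit Defensive.
Import Order.TTheory GRing.Theory Num.Theory.
Local Open Scope ring_scope.

(** * Almost commuting projections *)

Section SquaredNorm.
Variables (R : realFieldType) (Z : finType).
Implicit Types f g h : {ffun Z -> R}.

Definition sqnorm f : R := \sum_x f x ^+ 2.

Lemma sqnorm_ge0 f : 0 <= sqnorm f.
Proof. by apply: sumr_ge0 => x _; apply: sqr_ge0. Qed.

Lemma sqnormN f : sqnorm (- f) = sqnorm f.
Proof. by apply: eq_bigr => x _; rewrite ffunE sqrrN. Qed.

Lemma sqnormB f g : sqnorm (f - g) = sqnorm (g - f).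
Proof. by rewrite -sqnormN opprB. Qed.

Lemma sqnorm_add_le f g : sqnorm (f + g) <= 2 * sqnorm f + 2 * sqnorm g.
Proof.
rewrite /sqnorm !mulr_sumr -big_split /=; apply: ler_sum => x _.
by rewrite ffunE -subr_ge0; have := sqr_ge0 (f x - g x); rewrite !expr2; nra.
Qed.

Lemma sqnorm_add3_le f g h :
  sqnorm (f + g + h) <= 3 * sqnorm f + 3 * sqnorm g + 3 * sqnorm h.
Proof.
rewrite /sqnorm !mulr_sumr -!big_split /=; apply: ler_sum => x _.
rewrite !ffunE -subr_ge0.
have := sqr_ge0 (f x - g x); have := sqr_ge0 (f x - h x).
by have := sqr_ge0 (g x - h x); rewrite !expr2; nra.
Qed.

Section AlmostCommuting.
Variables (E0 E1 E2 : {ffun Z -> R} -> {ffun Z -> R}).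

Definition defect f := sqnorm (f - E0 f) + sqnorm (f - E1 f) + sqnorm (f - E2 f).

Lemma defect_ge0 f : 0 <= defect f.
Proof. by rewrite !addr_ge0 ?sqnorm_ge0. Qed.

Hypotheses (E0B : {morph E0 : f g / f - g}) (E1B : {morph E1 : f g / f - g})
           (E2B : {morph E2 : f g / f - g}).
Hypotheses (E0_le : forall f, sqnorm (E0 f) <= sqnorm f)
           (E1_le : forall f, sqnorm (E1 f) <= sqnorm f)
           (E2_le : forall f, sqnorm (E2 f) <= sqnorm f).

(** For each contraction E, g - E g splits as (g - f) + (f - E f) + E (f - g); this costs 6 for each
    of the three maps. *)
Lemma defect_shift f g : defect g <= 18 * sqnorm (f - g) + 3 * defect f.
Proof.
have main (E : {ffun Z -> R} -> {ffun Z -> R}) :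
    {morph E : f g / f - g} -> (forall f, sqnorm (E f) <= sqnorm f) ->
    sqnorm (g - E g) <= 6 * sqnorm (f - g) + 3 * sqnorm (f - E f).
  move=> EB E_le.
  have -> : g - E g = (g - f) + (f - E f) + E (f - g).
    by rewrite EB; apply/ffunP => x; rewrite !ffunE; ring.
  have := sqnorm_add3_le (g - f) (f - E f) (E (f - g)).
  have := E_le (f - g); rewrite (sqnormB g f); lra.
rewrite /defect; have := main _ E0B E0_le; have := main _ E1B E1_le.
have := main _ E2B E2_le; lra.
Qed.

Hypotheses (E0K : forall f, E0 (E0 f) = E0 f) (E1K : forall f, E1 (E1 f) = E1 f)
           (E2K : forall f, E2 (E2 f) = E2 f).
Variable theta : R.
Hypotheses (theta_ge0 : 0 <= theta)
  (E01_comm : forall f, sqnorm (E1 (E0 f) - E0 (E1 f)) <= theta * defect f)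
  (E12_comm : forall f, sqnorm (E2 (E1 f) - E1 (E2 f)) <= theta * defect f)
  (E02_comm : forall f, sqnorm (E2 (E0 f) - E0 (E2 f)) <= theta * defect f).

(** The difference telescopes into the three residuals of f, two of them pushed through
    contractions. *)
Lemma sqnorm_sub_prod f : sqnorm (f - E0 (E1 (E2 f))) <= 3 * defect f.
Proof.
have -> : f - E0 (E1 (E2 f)) = (f - E0 f) + E0 (f - E1 f) + E0 (E1 (f - E2 f)).
  by rewrite !(E0B, E1B); apply/ffunP => x; rewrite !ffunE; ring.
have := sqnorm_add3_le (f - E0 f) (E0 (f - E1 f)) (E0 (E1 (f - E2 f))).
have := E0_le (f - E1 f); have := E0_le (E1 (f - E2 f)).
have := E1_le (f - E2 f); rewrite /defect; lra.
Qed.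

(** E0 fixes the product exactly, E1 fixes g and E2 fixes E2 f. Hence the residuals of the product
    under E1 and E2 consist of commutators only, and each commutator brings a factor theta. The sum
    is 39 + 2 * 39 + 2 * 21 = 159. *)
Lemma defect_prod f : defect (E0 (E1 (E2 f))) <= 160 * theta * defect f.
Proof.
set g := E1 (E2 f); have d0 := defect_ge0 f.
have le1 : sqnorm (f - E2 f) <= defect f.
  by rewrite /defect; have := sqnorm_ge0 (f - E0 f);
     have := sqnorm_ge0 (f - E1 f); lra.
have le2 : sqnorm (f - g) <= 2 * defect f.
  have -> : f - g = (f - E1 f) + E1 (f - E2 f).
    by rewrite E1B; apply/ffunP => x; rewrite !ffunE; ring.
  have := sqnorm_add_le (f - E1 f) (E1 (f - E2 f)).
  have := E1_le (f - E2 f); rewrite /defect.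
  by have := sqnorm_ge0 (f - E0 f); lra.
have dg : theta * defect g <= 39 * (theta * defect f).
  rewrite mulrCA ler_wpM2l //; have := defect_shift f g; lra.
have d2 : theta * defect (E2 f) <= 21 * (theta * defect f).
  rewrite mulrCA ler_wpM2l //; have := defect_shift f (E2 f); lra.
have h1 : sqnorm (E0 g - E1 (E0 g)) <= theta * defect g.
  by rewrite sqnormB; have := E01_comm g; rewrite {2}/g E1K.
have h2 : sqnorm (E0 g - E2 (E0 g)) <=
    2 * (theta * defect g) + 2 * (theta * defect (E2 f)).
  have -> : E0 g - E2 (E0 g) = (E0 (E2 g) - E2 (E0 g)) + E0 (g - E2 g).
    by rewrite E0B; apply/ffunP => x; rewrite !ffunE; ring.
  apply: le_trans (sqnorm_add_le _ _) _.
  have := E02_comm g; rewrite sqnormB => hg; have := E0_le (g - E2 g).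
  have := E12_comm (E2 f); rewrite E2K -/g sqnormB; lra.
rewrite [defect (E0 g)]/defect E0K subrr.
have -> : sqnorm 0 = 0.
  by rewrite /sqnorm big1 // => x _; rewrite ffunE expr0n.
have : 0 <= theta * defect f by rewrite mulr_ge0.
lra.
Qed.

End AlmostCommuting.

(** Turns an angle estimate relative to f - E f into a commutator bound by the residuals of A and B,
    the form needed for [defect]. As A (B f) is close to E f, the norm of f - E f is itself at most
    6 times these residuals; the term 3 * eta * d is absorbed thanks to 6 * eta <= 1. *)
Lemma comm_from_angle (A B E : {ffun Z -> R} -> {ffun Z -> R}) (eta : R) f :
    {morph A : f g / f - g} -> (forall f, sqnorm (A f) <= sqnorm f) ->
    0 <= eta -> 6 * eta <= 1 ->
    sqnorm (A (B f) - E f) <= eta * sqnorm (f - E f) ->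
    sqnorm (B (A f) - E f) <= eta * sqnorm (f - E f) ->
  sqnorm (B (A f) - A (B f)) <=
    24 * eta * (sqnorm (f - A f) + sqnorm (f - B f)).
Proof.
move=> AB A_le eta0 eta6 hAB hBA; set d := sqnorm (f - E f) in hAB hBA *.
have d0 : 0 <= d by apply: sqnorm_ge0.
have hd : d <= 6 * (sqnorm (f - A f) + sqnorm (f - B f)).
  have dE : d <= 3 * sqnorm (f - A f) + 3 * sqnorm (f - B f) + 3 * (eta * d).
    rewrite {1}/d.
    have -> : f - E f = (f - A f) + A (f - B f) + (A (B f) - E f).
      by rewrite AB; apply/ffunP => x; rewrite !ffunE; ring.
    apply: le_trans (sqnorm_add3_le _ _ _) _.
    have := A_le (f - B f); lra.
  have : 6 * eta * d <= d by rewrite ler_piMl.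
  lra.
have -> : B (A f) - A (B f) = (B (A f) - E f) - (A (B f) - E f).
  by apply/ffunP => x; rewrite !ffunE; ring.
apply: le_trans (sqnorm_add_le _ _) _; rewrite sqnormN.
have : eta * d <= eta * (6 * (sqnorm (f - A f) + sqnorm (f - B f))).
  exact: ler_wpM2l.
lra.
Qed.

End SquaredNorm.

(** * Averages over Heisenberg groups *)

Lemma sum_const_natl (R : pzRingType) (I : finType) (c : R) :
  \sum_(i : I) c = #|I|%:R * c.
Proof. by rewrite sumr_const mulr_natl. Qed.

Section Averages.
Variables (R : realFieldType) (gT : finGroupType) (Z : finType).
Variable to : {action gT &-> Z}.
Implicit Types f : {ffun Z -> R}.

Definition translate (h : gT) f : {ffun Z -> R} := [ffun x => f (to x h)].

Lemma translateB h : {morph translate h : f g / f - g}.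
Proof. by move=> f g; apply/ffunP => x; rewrite !ffunE. Qed.

Lemma translateM g h f : translate g (translate h f) = translate (g * h)%g f.
Proof. by apply/ffunP => x; rewrite !ffunE actM. Qed.

Lemma sqnorm_translate h f : sqnorm (translate h f) = sqnorm f.
Proof.
rewrite /sqnorm [RHS](reindex_inj (act_inj to h)) /=.
by apply: eq_bigr => x _; rewrite ffunE.
Qed.

Definition corr f (h : gT) : R := \sum_x f x * f (to x h).

Definition avg (I : finType) (g : I -> gT) f : {ffun Z -> R} :=
  [ffun x => #|I|%:R^-1 * \sum_i f (to x (g i))].

Lemma avgB (I : finType) (g : I -> gT) : {morph avg g : f h / f - h}.
Proof.
move=> f h; apply/ffunP => x; rewrite !ffunE -mulrBr -sumrB.
by congr (_ * _); apply: eq_bigr => i _; rewrite !ffunE.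
Qed.

(** By invariance of the sum over Z, the norm of an average depends only on correlations along
    quotients of group elements; norm estimates become counting in the group. *)
Lemma sqnorm_avg (I : finType) (g : I -> gT) f :
  sqnorm (avg g f) =
    #|I|%:R^-1 ^+ 2 * \sum_i \sum_j corr f ((g i)^-1 * g j)%g.
Proof.
rewrite /sqnorm; under eq_bigr => x _ do rewrite ffunE exprMn.
rewrite -mulr_sumr; congr (_ * _).
under eq_bigr => x _ do rewrite expr2 big_distrl /=.
rewrite exchange_big /=; apply: eq_bigr => i _.
under eq_bigr => x _ do rewrite big_distrr /=.
rewrite exchange_big /=; apply: eq_bigr => j _.
rewrite [LHS](reindex_inj (act_inj to (g i)^-1%g)) /=.
by apply: eq_bigr => x _; rewrite actKV actM.
Qed.

Lemma avg_sub_le (I : finType) (g : I -> gT) f (c : R) : (0 < #|I|)%N ->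
  (forall i, sqnorm (f - translate (g i) f) <= c) -> sqnorm (f - avg g f) <= c.
Proof.
move=> I0 gc; have n0 : 0 < #|I|%:R :> R by rewrite ltr0n.
have jensen (u : I -> R) :
    (#|I|%:R^-1 * \sum_i u i) ^+ 2 <= #|I|%:R^-1 * \sum_i u i ^+ 2.
  set m := _ * _; have mE : #|I|%:R * m = \sum_i u i.
    by rewrite mulrA divff ?mul1r ?gt_eqF.
  have : 0 <= \sum_i (u i - m) ^+ 2 by apply: sumr_ge0 => i _; apply: sqr_ge0.
  have -> : \sum_i (u i - m) ^+ 2 = \sum_i u i ^+ 2 - #|I|%:R * m ^+ 2.
    transitivity (\sum_i (u i ^+ 2 + (- (2 * m) * u i + m ^+ 2))).
      by apply: eq_bigr => i _; ring.
    by rewrite !big_split /= -mulr_sumr -mE sum_const_natl; ring.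
  by rewrite subr_ge0 [X in _ -> _ <= X]mulrC ler_pdivlMr // mulrC.
have {gc} : #|I|%:R^-1 * \sum_i sqnorm (f - translate (g i) f) <= c.
  rewrite mulrC ler_pdivrMr //; apply: le_trans (ler_sum _ (fun i _ => gc i)) _.
  by rewrite sum_const_natl mulrC.
apply: le_trans; rewrite /sqnorm exchange_big mulr_sumr /=.
apply: ler_sum => x _; rewrite !ffunE.
have -> : f x - #|I|%:R^-1 * (\sum_i f (to x (g i))) =
    #|I|%:R^-1 * \sum_i (f x - f (to x (g i))).
  by rewrite sumrB mulrBr sum_const_natl mulKf ?gt_eqF.
apply: le_trans (jensen _) _; rewrite ler_pM2l ?invr_gt0 //.
by apply: ler_sum => i _; rewrite !ffunE.
Qed.

Lemma sqnorm_avg_le (I : finType) (g : I -> gT) f : (0 < #|I|)%N ->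
  sqnorm (avg g f) <= sqnorm f.
Proof.
move=> I0; have n0 : 0 < #|I|%:R :> R by rewrite ltr0n.
rewrite sqnorm_avg.
have corr_le h : corr f h <= sqnorm f.
  suff : 2 * corr f h <= sqnorm f + sqnorm (translate h f).
    rewrite sqnorm_translate; lra.
  rewrite /sqnorm /corr mulr_sumr -big_split /=; apply: ler_sum => x _.
  rewrite ffunE -subr_ge0; have := sqr_ge0 (f x - f (to x h)).
  by congr (0 <= _); ring.
apply: (@le_trans _ _ (#|I|%:R^-1 ^+ 2 * \sum_(i : I) \sum_(j : I) sqnorm f)).
  by rewrite ler_pM2l ?exprn_gt0 ?invr_gt0 //; do 2 apply: ler_sum => ? _.
rewrite !sum_const_natl expr2 !mulrA mulfVK ?gt_eqF //.
by rewrite mulVf ?mul1r ?gt_eqF.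
Qed.

Lemma avg_comp (I J : finType) (g : I -> gT) (h : J -> gT) f :
  avg g (avg h f) = avg (fun ij : I * J => g ij.1 * h ij.2)%g f.
Proof.
apply/ffunP => x; rewrite !ffunE card_prod natrM invfM -mulrA; congr (_ * _).
rewrite -(pair_bigA _ (fun i j => f (to x (g i * h j)%g))) mulr_sumr /=.
apply: eq_bigr => i _; rewrite ffunE; congr (_ * _).
by apply: eq_bigr => j _; rewrite actM.
Qed.

Lemma avg_reindex (I J : finType) (g : I -> gT) (s : J -> I) f :
  bijective s -> avg (fun j => g (s j)) f = avg g f.
Proof.
move=> bs; apply/ffunP => x; rewrite !ffunE (bij_eq_card bs); congr (_ * _).
by rewrite [RHS](reindex s) //; apply: onW_bij.
Qed.

(** Left multiplication by each g i merely permutes the family h. This gives both the idempotence of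
    averages over subgroups and the absorption of root averages by the group average. *)
Lemma avg_absorbl (I J : finType) (g : I -> gT) (h : J -> gT)
    (s : I -> J -> J) f : (0 < #|I|)%N ->
  (forall i, injective (s i)) -> (forall i j, g i * h j = h (s i j))%g ->
  avg g (avg h f) = avg h f.
Proof.
move=> I0 s_inj ghE; apply/ffunP => x; rewrite [LHS]ffunE.
under eq_bigr => i _.
  have -> : avg h f (to x (g i)) = avg h f x.
    rewrite !ffunE [in RHS](reindex_inj (s_inj i)) /=; congr (_ * _).
    by apply: eq_bigr => j _; rewrite -ghE actM.
  over.
by rewrite sum_const_natl mulKf // pnatr_eq0 -lt0n.
Qed.

End Averages.

Section Heisenberg.
Variable F : finFieldType.

(* (a, b, z) is the unitriangular matrix with entries a, b above the diagonal
   and z in the corner. *)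
Definition heis : finType := (F * F * F)%type.

Definition heis_mul (g h : heis) : heis :=
  (g.1.1 + h.1.1, g.1.2 + h.1.2, g.2 + h.2 + g.1.1 * h.1.2).

Definition heis_inv (g : heis) : heis :=
  (- g.1.1, - g.1.2, - g.2 + g.1.1 * g.1.2).

(** An automorphism exchanging the two root subgroups; it transports the angle estimate to the
    product in the opposite order. *)
Definition heis_swap (g : heis) : heis := (g.1.2, g.1.1, g.1.1 * g.1.2 - g.2).

Definition heis_a (a : F) : heis := (a, 0, 0).
Definition heis_b (b : F) : heis := (0, b, 0).

Lemma heis_mulgV g : heis_mul g (heis_inv g) = (0, 0, 0).
Proof. by case: g => [[a b] z]; rewrite /heis_mul /=; congr (_, _, _); ring. Qed.

Lemma heis_invK : involutive heis_inv.
Proof. by case=> [[a b] z]; rewrite /heis_inv /=; congr (_, _, _); ring. Qed.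

Lemma heis_swapK : involutive heis_swap.
Proof. by case=> [[a b] z]; rewrite /heis_swap /=; congr (_, _, _); ring. Qed.

Lemma heis_swapM : {morph heis_swap : g h / heis_mul g h}.
Proof.
by case=> [[a b] z] [[a' b'] z']; rewrite /heis_swap /heis_mul /=;
   congr (_, _, _); ring.
Qed.

Lemma heis_mul_injl g : injective (heis_mul g).
Proof.
case: g => [[a b] z] [[a1 b1] z1] [[a2 b2] z2] [/addrI -> /addrI ->].
by move=> /addIr /addrI ->.
Qed.

Variables (R : realFieldType) (gT : finGroupType) (Z : finType).
Variable to : {action gT &-> Z}.
Local Notation q := (#|F|%:R : R).
Implicit Types (f : {ffun Z -> R}) (psi : heis -> gT).

Definition avg_a psi f := avg to (fun a => psi (heis_a a)) f.
Definition avg_b psi f := avg to (fun b => psi (heis_b b)) f.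

Lemma card_field_gt0 : (0 < #|F|)%N.
Proof. by apply/card_gt0P; exists 0. Qed.

Lemma card_heis_gt0 : (0 < #|heis|)%N.
Proof. by apply/card_gt0P; exists (0, 0, 0). Qed.

(* For a <> 0 the product a t runs through F with t; this is what makes the
   averages over the two generating subgroups nearly independent. *)
Lemma sum_twisted (c : F -> F -> F -> R) :
  \sum_a \sum_b \sum_t c a b (a * t) =
  \sum_a \sum_b \sum_z c a b z + q * \sum_b c 0 b 0
    - \sum_b \sum_z c 0 b z.
Proof.
rewrite (bigD1 (0 : F)) //= [in RHS](bigD1 (0 : F)) //=.
have -> : \sum_(a | a != 0) \sum_b \sum_t c a b (a * t) =
          \sum_(a | a != 0) \sum_b \sum_z c a b z.
  apply: eq_bigr => a a0; apply: eq_bigr => b _.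
  by rewrite [RHS](reindex_inj (mulfI a0)).
have -> : \sum_b \sum_t c 0 b (0 * t) = q * \sum_b c 0 b 0.
  rewrite mulr_sumr; apply: eq_bigr => b _.
  under eq_bigr => t _ do rewrite mul0r.
  by rewrite sum_const_natl.
by ring.
Qed.

(** The products of a, b and of a', b' differ by the element (a' - a, b' - b, (a' - a) b'). By
    [sum_twisted] the terms with a' <> a are spread evenly over the corner entry, as in the average
    over the whole group. The terms with a' = a cost the norm of the b-average over q, and the
    subtracted sum is a multiple of the squared norm of the average over the subgroup a = 0, hence
    nonnegative. *)
Lemma heis_angle psi f : {morph psi : g h / heis_mul g h >-> (g * h)%g} ->
  sqnorm (avg_a psi (avg_b psi f)) <=
    sqnorm (avg to psi f) + q^-1 * sqnorm f.
Proof.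
move=> psiM; have q0 : 0 < q by rewrite ltr0n card_field_gt0.
have psi1 : psi (0, 0, 0) = 1%g.
  apply: (@mulgI _ (psi (0, 0, 0))).
  by rewrite mulg1 -psiM /heis_mul /= mulr0 !addr0.
have psiV g : (psi g)^-1%g = psi (heis_inv g).
  by apply: (mulgI (psi g)); rewrite mulgV -psiM heis_mulgV psi1.
pose c a b z := corr to f (psi (a, b, z)).
have cE g h : corr to f ((psi g)^-1 * psi h)%g =
    c (h.1.1 - g.1.1) (h.1.2 - g.1.2) (h.2 - g.2 - g.1.1 * (h.1.2 - g.1.2)).
  rewrite psiV -psiM /c; congr (corr _ _ (psi _)).
  by rewrite /heis_mul /=; congr (_, _, _); ring.
have sumB (u : F -> R) a : \sum_x u (x - a) = \sum_x u x.
  by rewrite [RHS](reindex_inj (addIr (- a))).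
have sumN (u : F -> R) a : \sum_x u (a - x) = \sum_x u x.
  rewrite [RHS](reindex_inj (_ : injective (fun x => a - x))) //=.
  by move=> x y /addrI /oppr_inj.
have lhsE : sqnorm (avg_a psi (avg_b psi f)) =
    q^-1 ^+ 3 * \sum_a \sum_b \sum_t c a b (a * t).
  rewrite /avg_a /avg_b avg_comp sqnorm_avg card_prod natrM.
  have -> : \sum_(i : F * F) \sum_(j : F * F)
     corr to f ((psi (heis_a i.1) * psi (heis_b i.2))^-1 *
                (psi (heis_a j.1) * psi (heis_b j.2)))%g =
     q * \sum_a \sum_b \sum_t c a b (a * t).
    under eq_bigr => i _ do under eq_bigr => j _ do
      rewrite -!psiM cE /heis_mul /= !(addr0, add0r).
    rewrite -(pair_bigA _ (fun a b => \sum_(j : F * F)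
      c (j.1 - a) (j.2 - b) (j.1 * j.2 - a * b - a * (j.2 - b)))) /=.
    have -> : q * (\sum_a \sum_b \sum_t c a b (a * t)) =
       \sum_(i : F) \sum_a \sum_t \sum_b c a b (a * t).
      rewrite sum_const_natl; congr (_ * _).
      by apply: eq_bigr => a _; rewrite exchange_big.
    apply: eq_bigr => a _.
    under eq_bigr => b _ do rewrite -(pair_bigA _ (fun a' b' =>
      c (a' - a) (b' - b) (a' * b' - a * b - a * (b' - b)))) /=.
    rewrite exchange_big /= -[RHS](sumB _ a); apply: eq_bigr => a' _.
    rewrite exchange_big /=; apply: eq_bigr => b' _.
    by rewrite -[RHS](sumN _ b'); apply: eq_bigr => b _; congr (c _ _ _); ring.
  by field; rewrite gt_eqF.
have avgHE : sqnorm (avg to psi f) = q^-1 ^+ 3 * \sum_a \sum_b \sum_z c a b z.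
  rewrite sqnorm_avg card_prod card_prod !natrM.
  have -> : \sum_i \sum_j corr to f ((psi i)^-1 * psi j)%g =
      q ^+ 3 * \sum_a \sum_b \sum_z c a b z.
    under eq_bigr => i _.
      have -> : \sum_j corr to f ((psi i)^-1 * psi j)%g =
                \sum_a \sum_b \sum_z c a b z.
        rewrite (pair_bigA _ (fun a b => \sum_z c a b z)).
        rewrite (pair_bigA _ (fun p z => c p.1 p.2 z)) /=.
        rewrite (reindex_inj (heis_mul_injl (g := i))) /=.
        apply: eq_bigr => [[[a b] z]] _.
        by rewrite psiM mulKg.
      over.
    by rewrite sum_const_natl !card_prod !natrM; congr (_ * _); ring.
  by field; rewrite gt_eqF.
have bE : \sum_b c 0 b 0 = q * sqnorm (avg_b psi f).
  rewrite /avg_b sqnorm_avg.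
  under [X in _ = _ * (_ * X)]eq_bigr => i _.
    under eq_bigr => j _ do rewrite cE /= mul0r !subr0.
    rewrite (sumB (fun b => c 0 b 0)); over.
  by rewrite sum_const_natl; field; rewrite gt_eqF.
have bzE : 0 <= \sum_b \sum_z c 0 b z.
  have -> : \sum_b \sum_z c 0 b z = #|{: F * F}|%:R *
      sqnorm (avg to (fun bz : F * F => psi (0, bz.1, bz.2)) f).
    rewrite sqnorm_avg.
    under [X in _ = _ * (_ * X)]eq_bigr => i _.
      under eq_bigr => j _ do rewrite cE /= mul0r !subr0.
      rewrite -(pair_bigA _ (fun b z => c 0 (b - i.1) (z - i.2))) /=.
      under eq_bigr => b _ do rewrite (sumB (fun z => c 0 (b - i.1) z)).
      rewrite (sumB (fun b => \sum_z c 0 b z)); over.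
    rewrite sum_const_natl card_prod natrM; field.
    by rewrite gt_eqF.
  by rewrite mulr_ge0 ?sqnorm_ge0 ?ler0n.
rewrite lhsE sum_twisted avgHE bE mulrBr mulrDr -addrA lerD2l.
have -> : q^-1 ^+ 3 * (q * (q * sqnorm (avg_b psi f))) =
          q^-1 * sqnorm (avg_b psi f) by field; rewrite gt_eqF.
have : 0 <= q^-1 ^+ 3 * \sum_b \sum_z c 0 b z.
  by rewrite mulr_ge0 // exprn_ge0 // invr_ge0 ltW.
have : q^-1 * sqnorm (avg_b psi f) <= q^-1 * sqnorm f.
  by rewrite ler_pM2l ?invr_gt0 // sqnorm_avg_le ?card_field_gt0.
lra.
Qed.

(** Apply [heis_angle] to f - E f, whose group average is zero; E f is fixed by both root
    averages. *)
Lemma heis_angle_sub psi f : {morph psi : g h / heis_mul g h >-> (g * h)%g} ->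
  sqnorm (avg_a psi (avg_b psi f) - avg to psi f) <=
    q^-1 * sqnorm (f - avg to psi f).
Proof.
move=> psiM; have F0 := card_field_gt0; have H0 := card_heis_gt0.
set E := avg to psi; have EE : E (E f) = E f.
  exact: (avg_absorbl to f H0 heis_mul_injl (fun i j => esym (psiM i j))).
have aE : avg_a psi (E f) = E f.
  apply: (@avg_absorbl _ _ _ to _ _ _ _ (fun a => heis_mul (heis_a a))) => //.
    by move=> a; apply: heis_mul_injl.
have bE : avg_b psi (E f) = E f.
  apply: (@avg_absorbl _ _ _ to _ _ _ _ (fun b => heis_mul (heis_b b))) => //.
    by move=> b; apply: heis_mul_injl.
have -> : avg_a psi (avg_b psi f) - E f = avg_a psi (avg_b psi (f - E f)).
  by rewrite -{1}aE -{1}bE -2!avgB.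
have := heis_angle (f - E f) psiM; rewrite -/E /E avgB -/E EE subrr.
have -> : sqnorm (0 : {ffun Z -> R}) = 0.
  by rewrite /sqnorm big1 // => x _; rewrite ffunE expr0n.
by rewrite add0r.
Qed.

Lemma heis_comm psi f : {morph psi : g h / heis_mul g h >-> (g * h)%g} ->
  6 <= q ->
  sqnorm (avg_b psi (avg_a psi f) - avg_a psi (avg_b psi f)) <=
    24 * q^-1 * (sqnorm (f - avg_a psi f) + sqnorm (f - avg_b psi f)).
Proof.
move=> psiM q6; have q0 : 0 < q by rewrite ltr0n card_field_gt0.
apply: (@comm_from_angle _ _ _ _ (avg to psi)).
- exact: avgB.
- by move=> g; apply: sqnorm_avg_le card_field_gt0.
- by rewrite invr_ge0 ltW.
- by rewrite ler_pdivrMr // mul1r.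
- exact: heis_angle_sub.
have swM : {morph (fun g => psi (heis_swap g)) : g h / heis_mul g h >-> (g * h)%g}.
  by move=> g h; rewrite heis_swapM psiM.
have := heis_angle_sub f swM; rewrite avg_reindex; last exact: inv_bij heis_swapK.
rewrite /avg_a /avg_b.
have aE a : heis_swap (heis_a a) = heis_b a.
  by rewrite /heis_swap /= mulr0 subrr.
have bE b : heis_swap (heis_b b) = heis_a b.
  by rewrite /heis_swap /= mul0r subrr.
have avg_ext (g h : F -> gT) f' : g =1 h -> avg to g f' = avg to h f'.
  move=> gh; apply/ffunP => x; rewrite !ffunE; congr (_ * _).
  by apply: eq_bigr => i _; rewrite gh.
rewrite (avg_ext (fun a => psi (heis_swap (heis_a a))) (fun b => psi (heis_b b)));
  last by move=> a; rewrite aE.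
by rewrite (avg_ext (fun b => psi (heis_swap (heis_b b)))
                    (fun a => psi (heis_a a))) // => b; rewrite bE.
Qed.

End Heisenberg.

(** * The spectral gap *)

Section SpectralGap.
Variables (F : finFieldType) (R : realFieldType) (gT : finGroupType).
Variables (Z : finType) (to : {action gT &-> Z}).
Variable psi : 'Z_3 -> heis F -> gT.
Hypothesis psiM : forall i, {morph psi i : g h / heis_mul g h >-> (g * h)%g}.
Hypothesis psi_glue : forall i b, psi i (heis_b b) = psi (i + 1) (heis_a b).
Local Notation q := (#|F|%:R : R).
Implicit Types f : {ffun Z -> R}.

(** The b-subgroups are included: by [psi_glue] they are the a-subgroups of the next index. *)
Definition root_gen : {set gT} := [set psi x.1 (heis_a x.2) | x : 'Z_3 * F].

Definition root_group : {group gT} := <<root_gen>>%G.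

Definition proj_root i f := avg_a to (psi i) f.

Definition proj_group f := avg to (fun g : subg_of root_group => val g) f.

Definition root_defect f :=
  defect (proj_root 0) (proj_root 1) (proj_root 2) f.

Lemma root_group_card_gt0 : (0 < #|subg_of root_group|)%N.
Proof. by apply/card_gt0P; exists 1%g. Qed.

Lemma proj_root_le i f : sqnorm (proj_root i f) <= sqnorm f.
Proof. exact: sqnorm_avg_le (card_field_gt0 F). Qed.

Lemma proj_rootK i f : proj_root i (proj_root i f) = proj_root i f.
Proof.
apply: (@avg_absorbl _ _ _ to _ _ _ _ (fun a b => a + b)) => [|a b c /addrI //|].
  exact: card_field_gt0.
by move=> a b; rewrite -psiM /heis_mul /= mulr0 !addr0.
Qed.

Lemma avg_b_root i f : avg_b to (psi i) f = proj_root (i + 1) f.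
Proof.
apply/ffunP => x; rewrite !ffunE; congr (_ * _).
by apply: eq_bigr => b _; rewrite psi_glue.
Qed.

Lemma root_comm i f : 6 <= q ->
  sqnorm (proj_root (i + 1) (proj_root i f) - proj_root i (proj_root (i + 1) f))
   <= 24 * q^-1 * (sqnorm (f - proj_root i f) + sqnorm (f - proj_root (i + 1) f)).
Proof. by move=> q6; rewrite -!avg_b_root; apply: heis_comm. Qed.

Lemma root_defect_prod f : 6 <= q ->
  root_defect (proj_root 0 (proj_root 1 (proj_root 2 f))) <=
    3840 * q^-1 * root_defect f.
Proof.
move=> q6; have q0 : 0 <= 24 * q^-1 by rewrite mulr_ge0 ?invr_ge0 ?ler0n.
have -> : 3840 * q^-1 = 160 * (24 * q^-1) by ring.
apply: defect_prod => //; try by move=> *; apply: proj_rootK.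
all: try by move=> *; apply: proj_root_le.
all: try exact: avgB.
- move=> g; have := root_comm 0 g q6; rewrite add0r => le0.
  apply: le_trans le0 _; apply: ler_wpM2l => //.
  by rewrite /defect lerDl sqnorm_ge0.
- move=> g; have := root_comm 1 g q6; rewrite -[1 + 1]/2 => le1.
  apply: le_trans le1 _; apply: ler_wpM2l => //.
  by rewrite /defect -addrA lerDr sqnorm_ge0.
- have e0 : (2 + 1 : 'Z_3) = 0 by apply/eqP.
  move=> g; have := root_comm 2 g q6; rewrite e0 sqnormB => le2.
  apply: le_trans le2 _; apply: ler_wpM2l => //.
  have := sqnorm_ge0 (g - proj_root 1 g); rewrite /defect; lra.
Qed.

Lemma root_defect_ge i f : sqnorm (f - proj_root i f) <= root_defect f.
Proof.
have := sqnorm_ge0 (f - proj_root 0 f).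
have := sqnorm_ge0 (f - proj_root 1 f).
have := sqnorm_ge0 (f - proj_root 2 f).
have [-> | [-> | ->]] : i = 0 \/ i = 1 \/ i = 2.
  case: i => [[|[|[|//]]] ?]; [left | right; left | right; right]; exact: val_inj.
all: rewrite /root_defect /defect; lra.
Qed.

(** A root element fixes the projection to its own root subgroup, so f minus its translate equals
    the residual minus the translated residual. *)
Lemma translate_root_gen g f : g \in root_gen ->
  sqnorm (f - translate to g f) <= 4 * root_defect f.
Proof.
case/imsetP => [[i a] _ ->] /=; set h := psi i _.
have -> : f - translate to h f =
    (f - proj_root i f) + - translate to h (f - proj_root i f).
  have -> : translate to h (f - proj_root i f) = translate to h f - proj_root i f.
    rewrite translateB; congr (_ - _); apply/ffunP => x; rewrite !ffunE.
    congr (_ * _); rewrite [RHS](reindex_inj (addrI a)) /=.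
    apply: eq_bigr => b _; rewrite -actM -psiM /heis_mul /= mulr0 !addr0.
    by [].
  by apply/ffunP => x; rewrite !ffunE; ring.
have := sqnorm_add_le (f - proj_root i f) (- translate to h (f - proj_root i f)).
rewrite sqnormN sqnorm_translate; have := root_defect_ge i f; lra.
Qed.

Lemma translate_root_group g : g \in root_group ->
  exists K : nat, forall f, sqnorm (f - translate to g f) <= K%:R * root_defect f.
Proof.
case/gen_prodgP => n [c cA ->]; elim: n c cA => [|n IHn] c cA.
  exists 0%N => f; rewrite big_ord0 mul0r.
  have -> : translate to 1%g f = f by apply/ffunP => x; rewrite ffunE act1.
  by rewrite subrr /sqnorm big1 // => x _; rewrite ffunE expr0n.
have [|K KP] := IHn (fun i => c (lift ord0 i)); first by move=> i; apply: cA.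
exists (8 + 2 * K)%N => f; rewrite big_ord_recl /= -translateM.
set h := (\prod_(i < n) _)%g.
have -> : f - translate to (c ord0) (translate to h f) =
    (f - translate to (c ord0) f) + translate to (c ord0) (f - translate to h f).
  by rewrite translateB; apply/ffunP => x; rewrite !ffunE; ring.
apply: le_trans (sqnorm_add_le _ _) _; rewrite sqnorm_translate natrD natrM.
have := KP f; have := translate_root_gen f (cA ord0); lra.
Qed.

(** The constant comes from word lengths and depends on the group. Only its existence matters, as a
    start for the iteration of [gap_improve]. *)
Lemma weak_gap : exists K : nat, forall f,
  sqnorm (f - proj_group f) <= K%:R * root_defect f.
Proof.
have [K KP] := fin_all_exists (fun g : subg_of root_group =>
  translate_root_group (subgP g)).
exists (\sum_g K g)%N => f; apply: avg_sub_le => [|g].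
  exact: root_group_card_gt0.
apply: le_trans (KP g f) _; apply: ler_wpM2r; first exact: defect_ge0.
by rewrite ler_nat (bigD1 g) //= leq_addr.
Qed.

(* Replacing f by the product of the three projections costs a bounded multiple
   of the defect and shrinks the defect, so any constant K improves to
   18 + K / 2. *)
Lemma gap_improve (K : R) : 300 * 100 <= q -> 0 <= K ->
  (forall f, sqnorm (f - proj_group f) <= K * root_defect f) ->
  forall f, sqnorm (f - proj_group f) <= (18 + K / 2) * root_defect f.
Proof.
move=> q_ge K0 KP f; have q0 : 0 < q by lra.
set f' := proj_root 0 (proj_root 1 (proj_root 2 f)).
have d0 : 0 <= root_defect f by apply: defect_ge0.
(* 3840 / q <= 1/6 holds from q = 23040 on, within the assumed bound. The three terms below then
   give 3 * 3 + 3 * K / 6 + 3 * 3 = 18 + K / 2. *)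
have d' : root_defect f' <= 6^-1 * root_defect f.
  apply: le_trans (root_defect_prod f _) _; first lra.
  apply: ler_wpM2r => //; rewrite ler_pdivrMr //; lra.
have ff' : sqnorm (f - f') <= 3 * root_defect f.
  apply: sqnorm_sub_prod; try exact: avgB; move=> *; exact: proj_root_le.
have -> : f - proj_group f =
    (f - f') + (f' - proj_group f') + - proj_group (f - f').
  by rewrite /proj_group avgB; apply/ffunP => x; rewrite !ffunE; ring.
apply: le_trans (sqnorm_add3_le _ _ _) _; rewrite sqnormN.
have : sqnorm (proj_group (f - f')) <= sqnorm (f - f').
  by apply: sqnorm_avg_le root_group_card_gt0.
have : K * root_defect f' <= K * (6^-1 * root_defect f) by apply: ler_wpM2l.
have := KP f'; lra.
Qed.

(** Iterating K -> 18 + K / 2 tends to the fixed point 36 from any start; after K steps the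
    remainder K / 2^K is at most 1, whence 37. *)
Lemma spectral_gap f : 300 * 100 <= q ->
  sqnorm (f - proj_group f) <= 37 * root_defect f.
Proof.
move=> q_ge; have [K KP] := weak_gap.
have main m : forall f,
    sqnorm (f - proj_group f) <= (36 + K%:R / 2 ^+ m) * root_defect f.
  elim: m => [|m IHm] g.
    rewrite expr0 divr1; apply: le_trans (KP g) _.
    by apply: ler_wpM2r; [apply: defect_ge0 | lra].
  have K0 : 0 <= 36 + K%:R / 2 ^+ m :> R.
    by rewrite addr_ge0 ?divr_ge0 ?exprn_ge0 ?ler0n.
  apply: le_trans (gap_improve q_ge K0 IHm g) _; apply: ler_wpM2r.
    exact: defect_ge0.
  rewrite exprS invfM; lra.
apply: le_trans (main K f) _; apply: ler_wpM2r; first exact: defect_ge0.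
suff : K%:R / 2 ^+ K <= 1 :> R by lra.
by rewrite ler_pdivrMr ?exprn_gt0 // mul1r -natrX ler_nat ltnW // ltn_expl.
Qed.

End SpectralGap.

(** * The sentence and its models *)

Section Blocks.
Variable sigma : signature.
Variables (T : finType) (A : structure sigma T).

Lemma sat_All_block k n (f : formula sigma (k + n)) (v : n.-tuple T) :
  sat A (All_block f) v = [forall u : k.-tuple T, sat A f (cat_tuple u v)].
Proof.
elim: k f => [|k IHk] f /=.
  have cat0 (u : 0.-tuple T) : cat_tuple u v = v.
    by apply: val_inj; rewrite (tuple0 u).
  by apply/idP/forallP => [fv u | /(_ [tuple])]; rewrite cat0.
rewrite IHk; apply/forallP/forallP => /= H u; last first.
  apply/forallP => x; have := H (cons_tuple x u); congr (sat _ _ _).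
  exact: val_inj.
case/tupleP: u => x u; have /forallP/(_ x) := H u; congr (sat _ _ _).
exact: val_inj.
Qed.

Lemma sat_Ex_block k n (f : formula sigma (k + n)) (v : n.-tuple T) :
  sat A (Ex_block f) v = [exists u : k.-tuple T, sat A f (cat_tuple u v)].
Proof.
elim: k f => [|k IHk] f /=.
  have cat0 (u : 0.-tuple T) : cat_tuple u v = v.
    by apply: val_inj; rewrite (tuple0 u).
  by apply/idP/existsP => [fv | [u]]; [exists [tuple] | ]; rewrite cat0.
rewrite IHk; apply/existsP/existsP => /= [[u /existsP[x xP]] | [u]].
  exists (cons_tuple x u); move: xP; congr (sat _ _ _); exact: val_inj.
case/tupleP: u => x u xP; exists u; apply/existsP; exists x.
by move: xP; congr (sat _ _ _); exact: val_inj.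
Qed.

Definition conj_all n (I : finType) (P : pred I) (f : I -> formula sigma n) :=
  foldr (fun i g => And (f i) g) (Not (Bot sigma n)) (enum P).

Lemma sat_conj_all n (I : finType) (P : pred I) (f : I -> formula sigma n)
    (v : n.-tuple T) :
  sat A (conj_all P f) v = [forall (i | P i), sat A (f i) v].
Proof.
rewrite -[RHS]/[forall i in P, sat A (f i) v].
transitivity (all (fun i => sat A (f i) v) (enum P)).
  by rewrite /conj_all; elim: (enum P) => //= i s ->.
by apply/allP/forall_inP => fP i Pi; apply: fP; rewrite ?mem_enum // in Pi *.
Qed.

Lemma conj_all_qf n (I : finType) (P : pred I) (f : I -> formula sigma n) :
  (forall i, quantifier_free (f i)) -> quantifier_free (conj_all P f).
Proof.
by move=> fqf; rewrite /conj_all; elim: (enum P) => //= i s ->; rewrite fqf.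
Qed.

End Blocks.

Section ActionSentence.
Variables (S : finType) (e : S) (law : S -> S -> S -> bool).

Definition bin_sig : signature :=
  @Signature S (fun=> 2%N) (fun=> isT).

Definition pair_rel (T : finType) (A : structure bin_sig T) (s : S) (x y : T) :
    bool := [tuple x; y] \in A s.

Definition ex_var (s : S) : 'I_(#|S| + (3 + 0)) := lshift _ (enum_rank s).
Definition all_var (i : 'I_3) : 'I_(#|S| + (3 + 0)) := rshift _ (lshift 0 i).

Definition edge (s : S) (x y : 'I_(#|S| + (3 + 0))) :
    formula bin_sig (#|S| + (3 + 0)) :=
  @Rel bin_sig _ s [tuple x; y].

Definition implies (sigma : signature) n (f g : formula sigma n) := Or (Not f) g.

Definition action_matrix : formula bin_sig (#|S| + (3 + 0)) :=
  let x := all_var ord0 in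
  let y := all_var (inord 1) in
  let z := all_var (inord 2) in
  And (conj_all predT (fun s => edge s x (ex_var s)))
   (And (conj_all (fun l => law l.1.1 l.1.2 l.2)
           (fun l : S * S * S =>
              implies (And (edge l.1.1 x y) (edge l.1.2 y z)) (edge l.2 x z)))
        (implies (edge e x y) (@Eq bin_sig _ x y))).

Definition action_sentence : sentence bin_sig :=
  All_block (Ex_block action_matrix).

Lemma action_sentence_Pi2 : Pi2 action_sentence.
Proof.
exists 3%N, #|S|, action_matrix; split; last by move=> T A v.
by rewrite /= !conj_all_qf.
Qed.

Section Models.
Variables (T : finType) (A : structure bin_sig T).

Definition respects_laws : Prop :=
  [/\ forall s x, exists y, pair_rel A s x y,
      forall s t r x y z, law s t r ->
        pair_rel A s x y -> pair_rel A t y z -> pair_rel A r x z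
    & forall x y, pair_rel A e x y -> x = y].

Lemma sat_edge s i j v : sat A (edge s i j) v = pair_rel A s (tnth v i) (tnth v j).
Proof.
rewrite /pair_rel /=.
by have -> : map_tuple (tnth v) [tuple i; j] = [tuple tnth v i; tnth v j];
  first exact: val_inj.
Qed.

Lemma tnth_ex_var (w : #|S|.-tuple T) (u : 3.-tuple T) s :
  tnth (cat_tuple w (cat_tuple u [tuple])) (ex_var s) = tnth w (enum_rank s).
Proof. exact: tnth_lshift. Qed.

Lemma tnth_all_var (w : #|S|.-tuple T) (u : 3.-tuple T) i :
  tnth (cat_tuple w (cat_tuple u [tuple])) (all_var i) = tnth u i.
Proof. by rewrite tnth_rshift tnth_lshift. Qed.

Lemma sat_And n (f g : formula bin_sig n) v :
  sat A (And f g) v = sat A f v && sat A g v.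
Proof. by []. Qed.

Lemma sat_implies n (f g : formula bin_sig n) v :
  sat A (implies f g) v = (sat A f v ==> sat A g v).
Proof. by rewrite implybE. Qed.

Lemma sat_action_matrix (w : #|S|.-tuple T) x y z :
  sat A action_matrix (cat_tuple w (cat_tuple [tuple x; y; z] [tuple])) =
  [&& [forall s, pair_rel A s x (tnth w (enum_rank s))],
      [forall (l : S * S * S | law l.1.1 l.1.2 l.2),
         pair_rel A l.1.1 x y && pair_rel A l.1.2 y z ==> pair_rel A l.2 x z]
    & pair_rel A e x y ==> (x == y)].
Proof.
have u1 : tnth [tuple x; y; z] (inord 1) = y by rewrite (tnth_nth x) inordK.
have u2 : tnth [tuple x; y; z] (inord 2) = z by rewrite (tnth_nth x) inordK.
rewrite /action_matrix !sat_And !sat_conj_all sat_implies sat_edge.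
rewrite !tnth_all_var u1; congr [&& _, _ & _].
- by apply: eq_forallb => s; rewrite sat_edge tnth_all_var tnth_ex_var.
- apply: eq_forallb => l.
  by rewrite sat_implies sat_And !sat_edge !tnth_all_var u1 u2.
- by rewrite [sat _ _ _]/= !tnth_all_var u1.
Qed.

Lemma models_action_sentence : models A action_sentence <-> respects_laws.
Proof.
rewrite /models /action_sentence sat_All_block.
under eq_forallb => u do rewrite sat_Ex_block.
split=> [/forallP H | [tot lw ide]]; last first.
  apply/forallP => u; have [x [y [z ->]]] : exists x y z, u = [tuple x; y; z].
    case/tupleP: u => x u; case/tupleP: u => y u; case/tupleP: u => z u.
    by exists x, y, z; apply: val_inj; rewrite /= (tuple0 u).
  have [f fP] := fin_all_exists (fun s => tot s x).
  apply/existsP; exists [tuple f (enum_val i) | i < #|S|].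
  rewrite sat_action_matrix; apply/and3P; split.
  - by apply/forallP => s; rewrite tnth_mktuple enum_rankK.
  - apply/forallP => -[[s t] r]; apply/implyP => /= str.
    by apply/implyP => /andP[]; apply: lw.
  - by apply/implyP => /ide ->.
have K (x y z : T) : exists2 w : S -> T, (forall s, pair_rel A s x (w s)) &
    (forall s t r, law s t r -> pair_rel A s x y -> pair_rel A t y z ->
       pair_rel A r x z) /\ (pair_rel A e x y -> x = y).
  have /existsP[w] := H [tuple x; y; z].
  rewrite sat_action_matrix => /and3P[/forallP tot /forallP lw /implyP ide].
  exists (fun s => tnth w (enum_rank s)) => [s|]; first exact: tot.
  split=> [s t r str xy yz | /ide/eqP //].
  by have /implyP/(_ str)/implyP := lw (s, t, r); apply; rewrite /= xy.
split=> [s x | s t r x y z | x y].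
- by have [w wP _] := K x x x; exists (w s).
- by have [w _ [lw _]] := K x y z; apply: lw.
- by have [w _ [_]] := K x y x.
Qed.

(* Functionality is not part of the sentence: it follows from totality and the
   laws s * inv s = inv s * s = e. *)
Variable inv : S -> S.
Hypotheses (law_inv : forall s, law s (inv s) e) (invK : involutive inv).

Lemma models_perm : respects_laws -> exists phi : S -> {perm T},
  [/\ forall s x y, pair_rel A s x y = (phi s x == y), phi e = 1%g
    & forall s t r, law s t r -> (phi s * phi t)%g = phi r].
Proof.
case=> tot lw ide.
(* Totality gives some [inv s]-edge from y, and its end is joined to x by e, hence is x. Going back
   along [inv s] and forward along s then joins any two images of x by e, so the relations are
   functional. *)
have relV s x y : pair_rel A s x y -> pair_rel A (inv s) y x.
  move=> xy; have [z yz] := tot (inv s) y.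
  by rewrite (ide _ _ (lw _ _ _ _ _ _ (law_inv s) xy yz)).
have fn s x y y' : pair_rel A s x y -> pair_rel A s x y' -> y = y'.
  move=> /relV xy xy'; apply: ide.
  by apply: (lw _ _ _ _ _ _ (law_inv (inv s)) xy); rewrite invK.
have [f fP] := fin_all_exists (fun s => fin_all_exists (tot s)).
have fE s x y : pair_rel A s x y = (f s x == y).
  by apply/idP/eqP => [/(fn _ _ _ _ (fP s x)) | <-].
have fK s : cancel (f s) (f (inv s)).
  by move=> x; apply/eqP; rewrite -fE; apply: relV.
exists (fun s => perm (can_inj (fK s))); split=> [s x y | | s t r str].
- by rewrite permE fE.
- by apply/permP => x; rewrite permE perm1; apply/esym/ide.
- apply/permP => x; rewrite permM !permE; apply/esym/eqP; rewrite -fE.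
  exact: lw str (fP _ _) (fP _ _).
Qed.

End Models.
End ActionSentence.

(** * Structures far from every model *)

Section Symbols.
Variable F : finFieldType.

(* The symbol (i, g) acts as the element g of the i-th of three Heisenberg
   groups, whose b-subgroup is the a-subgroup of the next one. *)
Definition sym : finType := ('Z_3 * heis F)%type.

Definition sym_one : sym := (0, (0, 0, 0)).
Definition sym_inv (s : sym) : sym := (s.1, heis_inv s.2).

(** The clauses are multiplication inside one Heisenberg group, the gluing of a b-subgroup to the
    next a-subgroup, and inverses. Gluing identifies two symbols, but laws are ternary, so it is
    written as multiplication by [sym_one]. The last clause also identifies the units of the three
    groups. *)
Definition sym_law (s t r : sym) : bool :=
  [|| (t.1 == s.1) && (r == (s.1, heis_mul s.2 t.2)),
      [&& t == sym_one, s.2.1.1 == 0, s.2.2 == 0 & r == (s.1 + 1, heis_a s.2.1.2)]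
    | (t == sym_inv s) && (r == sym_one)].

Lemma sym_invK : involutive sym_inv.
Proof. by case=> i g; rewrite /sym_inv /= heis_invK. Qed.

Lemma sym_law_inv s : sym_law s (sym_inv s) sym_one.
Proof. by rewrite /sym_law !eqxx !orbT. Qed.

Definition lawful (gT : finGroupType) (psi : sym -> gT) : Prop :=
  psi sym_one = 1%g /\
  forall s t r, sym_law s t r -> (psi s * psi t)%g = psi r.

Section Lawful.
Variables (gT : finGroupType) (psi : sym -> gT).
Hypothesis psiL : lawful psi.

Lemma lawful_morph i :
  {morph (fun g => psi (i, g)) : g h / heis_mul g h >-> (g * h)%g}.
Proof. by move=> g h; rewrite (psiL.2 _ _ (i, heis_mul g h)) // /sym_law !eqxx. Qed.

Lemma lawful_glue i b : psi (i, heis_b b) = psi (i + 1, heis_a b).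
Proof.
rewrite -(psiL.2 (i, heis_b b) sym_one (i + 1, heis_a b)) ?psiL.1 ?mulg1 //.
by rewrite /sym_law !eqxx orbT.
Qed.

Lemma lawfulV s : psi (sym_inv s) = (psi s)^-1%g.
Proof.
apply: (mulgI (psi s)).
by rewrite mulgV (psiL.2 _ _ _ (sym_law_inv s)) psiL.1.
Qed.

End Lawful.
End Symbols.

Section PointStructure.
Variables (S : finType) (gT : finGroupType) (Z : finType).
Variables (to : {action gT &-> Z}) (psi : S -> gT).

(* The structure induced on T by labelling points of Z through j: an edge
   leaving the range of j is dropped. *)
Definition point_structure (T : finType) (j : T -> Z) : structure (bin_sig S) T :=
  [ffun s : bin_sig S => [set t : (ar s).-tuple T |
     to (j (tnth t ord0)) (psi s) == j (tnth t ord_max)]].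

Lemma pair_rel_point (T : finType) (j : T -> Z) s x y :
  pair_rel (point_structure j) s x y = (to (j x) (psi s) == j y).
Proof. by rewrite /pair_rel ffunE inE. Qed.

End PointStructure.

Lemma proj_group_inv (F : finFieldType) (R : realFieldType) (gT : finGroupType)
    (Z : finType) (to : {action gT &-> Z}) (psi : 'Z_3 -> heis F -> gT)
    (f : {ffun Z -> R}) x g :
  g \in root_group psi -> proj_group to psi f (to x g) = proj_group to psi f x.
Proof.
move=> gG; rewrite !ffunE; congr (_ * _).
rewrite [RHS](reindex_inj (mulgI (subg (root_group psi) g))) /=.
apply: eq_bigr => h _; rewrite -actM; congr (f (to x (_ * _)%g)).
by rewrite -[RHS]/(sgval _) subgK.
Qed.

Section Far.
Variables (F : finFieldType) (R : realFieldType) (Q : finGroupType).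
Variables (psi : sym F -> Q) (n : nat) (j : 'I_n -> Q).
Hypothesis q_ge : 300 * 100 <= #|F|%:R :> R.
Hypothesis psiL : lawful psi.
Hypothesis psi_gen : root_group (fun i g => psi (i, g)) = [set: Q] :> {set Q}.
Hypothesis n_lt : (n < #|Q|)%N.

Definition diag_act (x : Q * 'I_n) (g : Q * {perm 'I_n}) : Q * 'I_n :=
  ((x.1 * g.1)%g, g.2 x.2).

Lemma diag_act1 : diag_act^~ 1%g =1 id.
Proof. by case=> x y; rewrite /diag_act /= mulg1 perm1. Qed.

Lemma diag_actM x : act_morph diag_act x.
Proof. by case: x => x y g h; rewrite /diag_act /= mulgA permM. Qed.

Definition diag_action := TotalAction diag_act1 diag_actM.

Variable B : structure (bin_sig (sym F)) 'I_n.
Hypothesis B_laws : respects_laws (sym_one F) (@sym_law F) B.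

Local Notation A := (point_structure 'R psi j).

(* The diagonal {(j y, y)} is an almost invariant subset of Q * 'I_n when B is
   close to A; the spectral gap then yields an equivariant injection of Q into
   'I_n, which is too small to receive it. *)
Lemma point_structure_far : n%:R <= 888 * (sym_diff_card A B)%:R :> R.
Proof.
have [phi [phiE phi1 phiM]] := models_perm (@sym_law_inv F) (@sym_invK F) B_laws.
pose Psi s := (psi s, phi s).
have PsiL : lawful Psi.
  split=> [|s t r str]; first by rewrite /Psi psiL.1 phi1.
  by rewrite /Psi -(psiL.2 _ _ _ str) -(phiM _ _ _ str).
pose Psi' i g := Psi (i, g); pose G := root_group Psi'.
pose f : {ffun Q * 'I_n -> R} := [ffun p => (p.1 == j p.2)%:R].
pose h := proj_group diag_action Psi' f.
set D := sym_diff_card A B.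
have sqnorm2 (u : {ffun Q * 'I_n -> R}) : sqnorm u = \sum_y \sum_x u (x, y) ^+ 2.
  by rewrite exchange_big pair_bigA; apply: eq_bigr => -[x y].
(* The generators of G project onto those of Q, so G is transitive on the first coordinate. *)
have G_trans x x' : exists2 g : Q * {perm 'I_n}, g \in G & (x * g.1)%g = x'.
  suff [g gG gE] : exists2 g, g \in G & g.1 = (x^-1 * x')%g.
    by exists g => //; rewrite gE mulKVg.
  have : (x^-1 * x')%g \in root_group (fun i g => psi (i, g)).
    by rewrite psi_gen inE.
  case/gen_prodgP => m [c cA ->]; elim: m c cA => [|m IHm] c cA.
    by exists 1%g; rewrite ?group1 ?big_ord0.
  have [|g gG gE] := IHm (fun i => c (lift ord0 i)); first by move=> i; apply: cA.
  have /imsetP[[i a] _ cE] := cA ord0.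
  exists (Psi' i (heis_a a) * g)%g; last by rewrite big_ord_recl /= cE gE.
  by rewrite groupM // mem_gen //; apply/imsetP; exists (i, a).
(* Every translate of the diagonal meets each column in exactly one point. *)
have col_sum y : \sum_x h (x, y) = 1.
  under eq_bigr => x _ do rewrite ffunE.
  rewrite -mulr_sumr exchange_big /=.
  under eq_bigr => g _.
    have -> : \sum_x f (diag_act (x, y) (sgval g)) = 1.
      rewrite (bigD1 (j ((sgval g).2 y) * (sgval g).1^-1)%g) //=.
      rewrite ffunE /= mulgKV eqxx big1 ?addr0 // => x xP.
      by rewrite ffunE /=; case: eqP => // xg; case/eqP: xP; rewrite -xg mulgK.
    over.
  rewrite sum_const_natl mulr1 mulVf // pnatr_eq0 -lt0n.
  exact: root_group_card_gt0.
have h_ge0 p : 0 <= h p.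
  rewrite ffunE mulr_ge0 ?invr_ge0 ?ler0n // sumr_ge0 // => g _.
  by rewrite ffunE ler0n.
(* A bad y carries an edge of B that A lacks, so each symbol has at most D of them; in a bad column
   f and its translate differ in at most two points, in a good one nowhere. Three projections give 3
   * 2. *)
have defect_le : root_defect diag_action Psi' f <= 6 * D%:R.
  suff le2 i : sqnorm (f - proj_root diag_action Psi' i f) <= 2 * D%:R.
    have := le2 0; have := le2 1; have := le2 2.
    rewrite /root_defect /defect; lra.
  apply: avg_sub_le => [|a]; first exact: card_field_gt0.
  set s : sym F := (i, heis_a a).
  pose bad := [set y | (j y * psi s)%g != j (phi s y)].
  have bad_le : (#|bad| <= D)%N.
    have emb_inj : injective (fun y => [tuple y; phi s y]).
      by move=> y y' /(congr1 (@thead _ _)).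
    rewrite -(card_imset _ emb_inj) /D /sym_diff_card (bigD1 s) //=.
    apply: leq_trans (leq_addr _ _); apply: subset_leq_card.
    apply/subsetP => _ /imsetP[y yP ->]; rewrite !inE.
    rewrite inE in yP; apply/orP; right; apply/andP; split.
      by have := pair_rel_point 'R psi j s y (phi s y); rewrite /pair_rel => ->.
    by have := phiE s y (phi s y); rewrite eqxx.
  apply: (@le_trans _ _ (2 * #|bad|%:R)); last by rewrite ler_pM2l ?ler_nat.
  rewrite sqnorm2 -sum1_card natr_sum mulr_sumr [leRHS]big_mkcond /=.
  apply: ler_sum => y _; rewrite inE.
  have tE x : (f - translate diag_action (Psi' i (heis_a a)) f) (x, y) =
      (x == j y)%:R - ((x * psi s)%g == j (phi s y))%:R.
    by rewrite !ffunE.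
  case: eqP => [good | _] /=.
    rewrite big1 // => x _; rewrite tE -good (inj_eq (mulIg _)) subrr.
    by rewrite expr0n.
  rewrite mulr1; apply: (@le_trans _ _ (\sum_x
     ((x == j y)%:R + ((x * psi s)%g == j (phi s y))%:R))).
    apply: ler_sum => x _; rewrite tE.
    by case: (x == _); case: (_ == _); rewrite /= ?expr2; lra.
  rewrite big_split /= (bigD1 (j y)) //= eqxx big1 => [|x /negPf -> //].
  rewrite (bigD1 (j (phi s y) * (psi s)^-1)%g) //= mulgKV eqxx big1 => [|x xP].
    rewrite !addr0 -[true%:R]/1; lra.
  by case: eqP => // xg; case/eqP: xP; rewrite -xg mulgK.
rewrite leNgt; apply/negP => D_lt.
have gap : sqnorm (f - h) <= 37 * root_defect diag_action Psi' f.
  apply: spectral_gap => //; [exact: lawful_morph | exact: lawful_glue].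
have half_sq (t : R) : t <= 2^-1 -> 1 <= 4 * (1 - t) ^+ 2.
  rewrite expr2 => t_le; have : 0 <= (2^-1 - t) * (2^-1 - t).
    by rewrite mulr_ge0 // subr_ge0.
  nra.
(* Otherwise f - h is at least 1/2 at all n points of the diagonal, and n <= 4 * 37 * 6 * D = 888 *
   D. *)
have [y0 y0P] : exists y, 2^-1 < h (j y, y).
  apply/existsP; apply: contraT; rewrite negb_exists => /forallP hle.
  suff : n%:R <= 4 * sqnorm (f - h) by lra.
  rewrite sqnorm2 mulr_sumr -[n in n%:R]card_ord -[X in X <= _]mulr1.
  rewrite -sum_const_natl; apply: ler_sum => y _.
  rewrite (bigD1 (j y)) //= mulrDr.
  have : 0 <= \sum_(x | x != j y) (f - h) (x, y) ^+ 2.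
    by apply: sumr_ge0 => x _; apply: sqr_ge0.
  have -> : (f - h) (j y, y) = 1 - h (j y, y).
    by rewrite [LHS]ffunE [(- h) _]ffunE [f _]ffunE /= eqxx.
  have := hle y; rewrite -leNgt => /half_sq; lra.
(* Invariance and transitivity carry the large value to every row. A column is nonnegative with sum
   1, so it holds at most one such value, which makes m injective. *)
have mP x : exists y, 2^-1 < h (x, y).
  have [g gG <-] := G_trans (j y0) x; exists (g.2 y0).
  by have := proj_group_inv diag_action f (j y0, y0) gG; rewrite /= -/h => ->.
have [m {}mP] := fin_all_exists mP.
suff m_inj : injective m.
  by have := leq_card m m_inj; rewrite card_ord leqNgt n_lt.
move=> x x' mE; apply/eqP; apply: contraT => xx'.
have := col_sum (m x); rewrite (bigD1 x) //= (bigD1 x') 1?eq_sym //=.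
have : 0 <= \sum_(i | (i != x) && (i != x')) h (i, m x).
  by apply: sumr_ge0 => i _; apply: h_ge0.
have := mP x; have := mP x'; rewrite -mE; lra.
Qed.

End Far.

(** * Finite quotients *)

Section Quotients.
Variables (F : finFieldType) (N : nat).

(* Vectors in (F[t] / (t^N - 1))^3; t acts by shifting the second index. *)
Definition vec3 : finType := {ffun 'Z_3 * 'Z_N -> F}.
Implicit Types x : vec3.

(* The three Heisenberg groups are generated by the elementary matrices
   I + a t e_(i,i+1) and their neighbours, i read modulo 3. *)
Definition heis_map (s : sym F) x : vec3 :=
  [ffun p => x p + (p.1 == s.1 + 1)%:R * (s.2.1.1 * x (s.1, p.2 + 1))
     + (p.1 == s.1 + 2)%:R *
       (s.2.1.2 * x (s.1 + 1, p.2 + 1) + s.2.2 * x (s.1, p.2 + 2))].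

Lemma heis_mapM i g h x :
  heis_map (i, h) (heis_map (i, g) x) = heis_map (i, heis_mul g h) x.
Proof.
case: g h => [[a b] z] [[a' b'] z']; apply/ffunP => -[k l].
rewrite !ffunE /= !eqxx.
have -> : (i == i + 1) = false by case: i => [[|[|[|//]]] ?].
have -> : (i == i + 2) = false by case: i => [[|[|[|//]]] ?].
have -> : (i + 1 == i + 2) = false by case: i => [[|[|[|//]]] ?].
have -> : l + 1 + 1 = l + 2 by rewrite -addrA.
rewrite !mul0r !mul1r; ring.
Qed.

Lemma heis_map0 i x : heis_map (i, (0, 0, 0)) x = x.
Proof. by apply/ffunP => p; rewrite !ffunE /= !mul0r !(addr0, mulr0). Qed.

Lemma heis_map_can s : cancel (heis_map s) (heis_map (sym_inv s)).
Proof. by case: s => i g x; rewrite heis_mapM heis_mulgV heis_map0. Qed.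

Definition heis_perm s : {perm vec3} := perm (can_inj (heis_map_can s)).

Lemma heis_perm_lawful : lawful heis_perm.
Proof.
split; first by apply/permP => x; rewrite permE perm1 heis_map0.
move=> s t r /or3P[/andP[/eqP ts /eqP ->] | | /andP[/eqP -> /eqP ->]].
- case: s t ts => i g [_ h] /= ->; apply/permP => x.
  by rewrite permM !permE heis_mapM.
- case/and4P => /eqP -> /eqP a0 /eqP z0 /eqP ->; apply/permP => x.
  rewrite permM !permE heis_map0; apply/ffunP => p; rewrite !ffunE /= a0 z0.
  by rewrite !mul0r mulr0 !addr0 mulr0 addr0 -addrA.
- apply/permP => x; rewrite permM !permE heis_map_can.
  by rewrite heis_map0.
Qed.

Definition heis_group : {group {perm vec3}} :=
  root_group (fun i g => heis_perm (i, g)).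

Lemma heis_perm_a i a : heis_perm (i, heis_a a) \in heis_group.
Proof. by apply/mem_gen/imsetP; exists (i, a). Qed.

Lemma heis_perm_mem s : heis_perm s \in heis_group.
Proof.
have M i := lawful_morph heis_perm_lawful i.
have bG i b : heis_perm (i, heis_b b) \in heis_group.
  by rewrite (lawful_glue heis_perm_lawful) heis_perm_a.
case: s => i [[a b] z].
(* The first four factors form a commutator equal to the central element with corner z - a b; the
   last two contribute the remaining a b. *)
have -> : (a, b, z) = heis_mul (heis_mul (heis_mul (heis_mul (heis_mul
    (heis_a (- 1)) (heis_b (a * b - z))) (heis_a 1)) (heis_b (z - a * b)))
    (heis_a a)) (heis_b b).
  by rewrite /heis_mul /=; congr (_, _, _); ring.
by rewrite !M !groupM ?heis_perm_a ?bG.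
Qed.

Definition has_elementary (i j : 'Z_3) (c : 'Z_N) : Prop :=
  exists2 g : {perm vec3}, g \in heis_group &
    forall x p, g x p = x p + (p.1 == j)%:R * x (i, p.2 + c).

(** The Steinberg relation: the commutator of e_ij(t^c) and e_jl(t^c') is e_il(t^(c + c')). *)
Lemma elementary_comm i j l c c' : i != j -> i != l ->
  has_elementary i j c -> has_elementary j l c' -> has_elementary i l (c + c').
Proof.
move=> /negPf ij /negPf il [g gG gE] [h hG hE].
exists (g^-1 * h^-1 * g * h)%g; first by rewrite !groupM ?groupV.
move=> y p; have -> : y = g (h (h^-1 (g^-1 y)))%g by rewrite !permKV.
set x := (h^-1 (g^-1 y))%g.
have -> : (g^-1 * h^-1 * g * h)%g (g (h x)) = h (g x).
  by rewrite !permM !permK.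
rewrite !(gE, hE) /= ij il !eqxx !mul0r !addr0.
have -> : p.2 + c' + c = p.2 + (c + c') by rewrite -addrA [c' + c]addrC.
rewrite mul1r; ring.
Qed.

Lemma elementary_next i : has_elementary i (i + 1) 1.
Proof.
exists (heis_perm (i, heis_a 1)); first exact: heis_perm_a.
by move=> x p; rewrite permE ffunE /= mul1r !mul0r addr0 mulr0 addr0.
Qed.

(** Passing from the entry (0, 1) to (0, 2) by a commutator with degree 1, and back to (0, 1) by one
    with degree 2, multiplies the entry by t^3. *)
Lemma elementary_shift k : has_elementary 0 1 (1 + 3 * k)%:R.
Proof.
have n2 i : has_elementary i (i + 2) 2.
  apply: (@elementary_comm _ (i + 1)); try exact: elementary_next.
  - by case: i => [[|[|[|//]]] ?].
  - by case: i => [[|[|[|//]]] ?].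
  - have -> : i + 2 = i + 1 + 1 by rewrite -addrA.
    exact: elementary_next.
elim: k => [|k IHk]; first by have := elementary_next 0.
have h02 : has_elementary 0 2 ((1 + 3 * k)%:R + 1).
  by apply: (@elementary_comm _ 1) => //; have := elementary_next 1.
have -> : (1 + 3 * k.+1)%:R = (1 + 3 * k)%:R + 1 + 2 :> 'Z_N.
  by rewrite mulnS !natrD; ring.
by apply: (@elementary_comm _ 2) => //; have := n2 2.
Qed.

Lemma heis_group_card m : (3 * m < N)%N -> (m <= #|heis_group|)%N.
Proof.
move=> mN; case: (posnP m) => [-> // | m0]; have N1 : (1 < N)%N.
  by apply: leq_trans mN; rewrite ltnS muln_gt0.
have [g gG gE] := fin_all_exists2 (fun k : 'I_m => elementary_shift k).
rewrite -[m in (m <= _)%N]card_ord.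
suff g_inj : injective g.
  rewrite -(card_imset _ g_inj); apply: subset_leq_card.
  by apply/subsetP => _ /imsetP[k _ ->].
(* The image of a basis vector reveals the exponent 1 + 3 k, and for k < m these exponents are below
   N, hence distinct modulo N. *)
move=> k k' gkk'; pose x : vec3 := [ffun p => (p == (0, 0))%:R].
have := gE k x (1, - (1 + 3 * k)%:R); rewrite gkk' gE /= !ffunE /= !mul1r.
rewrite addNr eqxx => /addrI.
have [shE _ | _ /eqP] := eqVneq; last by rewrite eq_sym oner_eq0.
move: shE => /(congr1 snd) /= /eqP; rewrite addrC subr_eq0 => /eqP /(congr1 val).
have small (l : 'I_m) : (1 + 3 * l < N)%N.
  by have := ltn_ord l; lia.
rewrite /= !val_Zp_nat // !modn_small // => -[/eqP].
by rewrite eqn_mul2l /= => /eqP ?; apply/esym/val_inj.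
Qed.

End Quotients.

Lemma unbounded_quotients (F : finFieldType) (m : nat) :
  exists (Q : finGroupType) (psi : sym F -> Q),
    [/\ lawful psi, root_group (fun i g => psi (i, g)) = [set: Q] :> {set Q}
      & (m <= #|Q|)%N].
Proof.
set G := heis_group F (3 * m).+1.
pose psi s : subg_of G := subg G (heis_perm (3 * m).+1 s).
exists (subg_of G), psi; split.
- have [L1 LM] := heis_perm_lawful F (3 * m).+1.
  split=> [|s t r str]; first by rewrite /psi L1 morph1.
  by rewrite /psi -(LM _ _ _ str) morphM ?heis_perm_mem.
- apply/setP => q; rewrite inE -[q]sgvalK; have := subgP q.
  move: (sgval q) => g /gen_prodgP[k [c cA ->]].
  elim: k c cA => [|k IHk] c cA.
    by rewrite big_ord0 morph1 group1.
  have cG i : c i \in G by apply: mem_gen.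
  rewrite big_ord_recl morphM ?group_prod // groupM //; last exact: IHk.
  by have /imsetP[[i a] _ ->] := cA ord0; apply/mem_gen/imsetP; exists (i, a).
- have cardE : #|G| = #|subg_of G|.
    by rewrite -[RHS]cardsT -im_subg card_injm ?injm_subg.
  by apply: leq_trans (heis_group_card F (ltnSn _)) _; rewrite -/G cardE.
Qed.

(** * Coupling of random labellings *)

Section Labelings.
Variable n : nat.
Implicit Types (w : seq ('I_n * 'I_n)) (p : {perm 'I_n}).

(* Labellings (permutations sending labels to positions) extending the partial
   one given by the pairs in w. *)
Definition labelings w : {set {perm 'I_n}} :=
  [set p : {perm 'I_n} | all (fun ax => p ax.1 == ax.2) w].

Lemma labelingsP p w :
  reflect (forall a x, (a, x) \in w -> p a = x) (p \in labelings w).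
Proof.
rewrite inE; apply: (iffP allP) => [pw a x /pw/eqP // | pw [a x] /pw ->].
exact: eqxx.
Qed.

Lemma labelings_cons p a x w :
  (p \in labelings ((a, x) :: w)) = (p a == x) && (p \in labelings w).
Proof. by rewrite !inE. Qed.

Lemma sum_labelings_position (V : nmodType) (f : {perm 'I_n} -> V) w a :
  a \notin unzip1 w ->
  \sum_(p in labelings w) f p =
  \sum_(x | x \notin unzip2 w) \sum_(p in labelings ((a, x) :: w)) f p.
Proof.
move=> aw; rewrite (partition_big (fun p => p a) (fun x => x \notin unzip2 w)) /=.
  by apply: eq_bigr => x _; apply: eq_bigl => p; rewrite labelings_cons andbC.
move=> p /labelingsP pw; apply/negP => /mapP[[b x] bx /= pax].
by case/mapP: aw; exists (b, x) => //=; apply: (@perm_inj _ p); rewrite (pw _ _ bx).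
Qed.

Lemma sum_labelings_label (V : nmodType) (f : {perm 'I_n} -> V) w y :
  y \notin unzip2 w ->
  \sum_(p in labelings w) f p =
  \sum_(b | b \notin unzip1 w) \sum_(p in labelings ((b, y) :: w)) f p.
Proof.
move=> yw.
rewrite (partition_big (fun p => p^-1 y)%g (fun b => b \notin unzip1 w)) /=.
  apply: eq_bigr => b _; apply: eq_bigl => p; rewrite labelings_cons andbC.
  by congr (_ && _); apply/eqP/eqP => [<- | <-]; rewrite ?permKV ?permK.
move=> p /labelingsP pw; apply/negP => /mapP[[b x] bx /= pbE].
by case/mapP: yw; exists (b, x) => //=; rewrite -(pw _ _ bx) -pbE permKV.
Qed.

Lemma card_notin (s : seq 'I_n) :
  uniq s -> #|[pred x | x \notin s]| = (n - size s)%N.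
Proof.
move=> us; rewrite -(card_uniqP us) -[n in (n - _)%N]card_ord.
rewrite -(cardC (mem s)) addKn.
exact: eq_card.
Qed.

Definition matching w := uniq (unzip1 w) && uniq (unzip2 w).

Lemma card_labelings w : matching w -> #|labelings w| = (n - size w)`!.
Proof.
elim: w => [_ | [a x] w IHw].
  by rewrite subn0 -card_Sn; apply: eq_card => p; rewrite !inE.
case/andP => /= /andP[aw u1] /andP[xw u2].
have {}IHw : #|labelings w| = (n - size w)`! by apply: IHw; rewrite /matching u1.
(* Composing with the transposition of y and y' preserves the values prescribed by w, so all free
   positions are equally likely for a. *)
have le y y' : y \notin unzip2 w -> y' \notin unzip2 w ->
    (#|labelings ((a, y) :: w)| <= #|labelings ((a, y') :: w)|)%N.
  move=> yw yw'; rewrite -(card_imset _ (mulIg (tperm y y'))).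
  apply/subset_leq_card/subsetP => _ /imsetP[p + ->].
  rewrite !labelings_cons permM => /andP[/eqP -> /labelingsP pw].
  rewrite tpermL eqxx; apply/labelingsP => b z bz; rewrite permM (pw _ _ bz).
  have zw : z \in unzip2 w by apply/mapP; exists (b, z).
  by rewrite tpermD //; apply: contraTneq zw => <-.
have := IHw; rewrite -sum1_card (sum_labelings_position _ aw).
rewrite (eq_bigr (fun=> #|labelings ((a, x) :: w)|)); last first.
  by move=> y yw; rewrite sum1_card; apply/eqP; rewrite eqn_leq !le.
rewrite sum_nat_const card_notin //; rewrite size_map.
have szw : (size w < n)%N.
  rewrite -[ltnRHS]card_ord -(size_map fst) -(card_uniqP u1).
  apply: proper_card; apply/properP; split; first exact/subsetP.
  by exists a.
rewrite -(ltn_predK (_ : 0 < n - size w)%N) ?subn_gt0 // factS -subnS.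
by rewrite /= => /eqP; rewrite eqn_mul2l /= => /eqP.
Qed.

End Labelings.

Section Coupling.
Variables (R : realType) (sigma : signature) (d n : nat).
Local Notation algorithm := (algorithm R sigma d n).
Local Notation oracle := (oracle sigma d n).

Lemma output_prob_ge0 (ans : oracle) b (t : algorithm) : 0 <= output_prob ans b t.
Proof.
elim: t => /= [c | p /andP[p0 p1] t It u Iu | a i next IH //]; first exact: ler0n.
by rewrite addr_ge0 // mulr_ge0 // subr_ge0.
Qed.

Lemma output_prob_compl (ans : oracle) (t : algorithm) :
  output_prob ans true t + output_prob ans false t = 1.
Proof.
elim: t => /= [[] | p /andP[p0 p1] t It u Iu | a i next IH //];
  try by rewrite /=; lra.
transitivity (p * (output_prob ans true t + output_prob ans false t)
  + (1 - p) * (output_prob ans true u + output_prob ans false u)); first by ring.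
by rewrite It Iu; ring.
Qed.

Lemma output_prob_le1 (ans : oracle) (t : algorithm) : output_prob ans true t <= 1.
Proof.
by have := output_prob_compl ans t; have := output_prob_ge0 ans false t; lra.
Qed.

Variables (tag : eqType) (mk : tag -> 'I_n -> 'I_n -> fact sigma 'I_n).

(* [loc x i] is the answer at position x, the neighbour being given by its
   position; a labelling p turns it into an oracle on labels. *)
Definition oracle_of (loc : 'I_n -> 'I_d -> option (tag * 'I_n)) (p : {perm 'I_n}) :
    oracle :=
  fun a i => omap (fun ty => mk ty.1 a ((p^-1)%g ty.2)) (loc (p a) i).

(** Unnormalised: divided by the number of labellings extending w, this is the acceptance
    probability conditioned on w. *)
Definition total loc (w : seq ('I_n * 'I_n)) (t : algorithm) : R :=
  \sum_(p in labelings w) output_prob (oracle_of loc p) true t.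

Definition within loc (w : seq ('I_n * 'I_n)) r (t : algorithm) : Prop :=
  forall p, p \in labelings w -> (num_queries (oracle_of loc p) t <= r)%N.

Lemma total_ge0 loc w t : 0 <= total loc w t.
Proof. by apply: sumr_ge0 => p _; apply: output_prob_ge0. Qed.

Lemma total_le loc w t : matching w -> total loc w t <= (n - size w)`!%:R.
Proof.
move=> /card_labelings <-; rewrite -sum1_card natr_sum; apply: ler_sum => p _.
exact: output_prob_le1.
Qed.

Lemma within_cons loc ax w r t : within loc w r t -> within loc (ax :: w) r t.
Proof. by move=> tw p; case: ax => a x; rewrite labelings_cons => /andP[_ /tw]. Qed.

Lemma labelings_n0 (w : seq ('I_n * 'I_n)) :
  matching w -> exists p, p \in labelings w.
Proof. by move=> /card_labelings wE; apply/card_gt0P; rewrite wE fact_gt0. Qed.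

Variables loc0 loc1 : 'I_n -> 'I_d -> option (tag * 'I_n).

(* A joint partial labelling: triples (label, position in the first structure,
   position in the second one). *)
Local Notation state := (seq ('I_n * ('I_n * 'I_n))).
Implicit Types w : state.
Definition side0 w := [seq (a.1, a.2.1) | a <- w].
Definition side1 w := [seq (a.1, a.2.2) | a <- w].

Definition joint_matching w := matching (side0 w) && matching (side1 w).

(** [rel r w] is the coupling invariant: both sides of w look alike for r more queries. Following an
    edge spends one unit of r; placing a fresh label spends none, but fails on up to [beta]
    positions of each side. *)
Variables (rel : nat -> state -> Prop) (M beta : nat).
Hypothesis rel_mono : forall r w, rel r.+1 w -> rel r w.
Hypothesis rel_step : forall r w a x0 x1 i, rel r.+1 w -> (a, (x0, x1)) \in w ->
  match loc0 x0 i, loc1 x1 i with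
  | None, None => True
  | Some (u, y0), Some (v, y1) => u = v /\
     ((exists b, (b, (y0, y1)) \in w) \/
      [/\ y0 \notin unzip2 (side0 w), y1 \notin unzip2 (side1 w)
        & forall b, rel r ((b, (y0, y1)) :: w)])
  | _, _ => False
  end.
Hypothesis rel_fresh : forall r w a, rel r w -> (size w <= M)%N ->
  exists bad0 bad1 : {set 'I_n}, [/\ (#|bad0| <= beta)%N, (#|bad1| <= beta)%N
    & forall x0 x1, x0 \notin bad0 -> x1 \notin bad1 -> rel r ((a, (x0, x1)) :: w)].
Hypothesis M_lt : (M < n)%N.

Definition err : R := (2 * beta)%:R / (n - M)%:R.

Lemma err_ge0 : 0 <= err.
Proof. by rewrite divr_ge0 ?ler0n. Qed.

(** Each query reveals at most two labels, the queried one and its neighbour, hence 2 * r; it loses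
    at most [err], a bound for the chance of a bad position on either side. *)
Definition coupled (t : algorithm) : Prop := forall r w,
  rel r w -> joint_matching w -> (size w + 2 * r <= M)%N ->
  within loc0 (side0 w) r t -> within loc1 (side1 w) r t ->
  `|total loc0 (side0 w) t - total loc1 (side1 w) t| <=
    (n - size w)`!%:R * (r%:R * err).

Lemma joint_matching_cons a x0 x1 w :
  joint_matching ((a, (x0, x1)) :: w) =
  [&& joint_matching w, a \notin unzip1 (side0 w), x0 \notin unzip2 (side0 w)
    & x1 \notin unzip2 (side1 w)].
Proof.
rewrite /joint_matching /matching /=.
have -> : unzip1 (side1 w) = unzip1 (side0 w) by rewrite /unzip1 -!map_comp.
by case: (a \in _); case: (x0 \in _); case: (x1 \in _); rewrite /= ?andbF ?andbT.
Qed.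

(** A query at a placed label loses nothing, hence r and not r + 1 in the bound: both sides give the
    same tag, and the neighbour is either placed consistently or new on both sides. *)
Lemma coupled_known (a : 'I_n) (i : 'I_d) next r w :
  (forall o, coupled (next o)) ->
  rel r.+1 w -> joint_matching w -> (size w + 2 * r < M)%N ->
  a \in unzip1 (side0 w) ->
  within loc0 (side0 w) r.+1 (Query a i next) ->
  within loc1 (side1 w) r.+1 (Query a i next) ->
  `|total loc0 (side0 w) (Query a i next) - total loc1 (side1 w) (Query a i next)|
    <= (n - size w)`!%:R * (r%:R * err).
Proof.
move=> IH relw mw szw aw q0 q1.
have [x0 [x1 axw]] : exists x0 x1, (a, (x0, x1)) \in w.
  case/mapP: aw => -[b y] /mapP[[c [x0 x1]] cw [-> _]] /= ->; by exists x0, x1.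
have pos0 p : p \in labelings (side0 w) -> p a = x0.
  by move/labelingsP; apply; apply/mapP; exists (a, (x0, x1)).
have pos1 p : p \in labelings (side1 w) -> p a = x1.
  by move/labelingsP; apply; apply/mapP; exists (a, (x0, x1)).
have tot0 (o : {perm 'I_n} -> option (fact sigma 'I_n)) l :
    {in labelings l, forall p, oracle_of loc0 p a i = o p} ->
    total loc0 l (Query a i next) =
    \sum_(p in labelings l) output_prob (oracle_of loc0 p) true (next (o p)).
  by move=> oE; apply: eq_bigr => p pw /=; rewrite oE.
have tot1 (o : {perm 'I_n} -> option (fact sigma 'I_n)) l :
    {in labelings l, forall p, oracle_of loc1 p a i = o p} ->
    total loc1 l (Query a i next) =
    \sum_(p in labelings l) output_prob (oracle_of loc1 p) true (next (o p)).
  by move=> oE; apply: eq_bigr => p pw /=; rewrite oE.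
have same o w' : rel r w' -> joint_matching w' -> (size w' + 2 * r <= M)%N ->
    {subset w <= w'} ->
    {in labelings (side0 w'), forall p, oracle_of loc0 p a i = o} ->
    {in labelings (side1 w'), forall p, oracle_of loc1 p a i = o} ->
    `|total loc0 (side0 w') (next o) - total loc1 (side1 w') (next o)|
      <= (n - size w')`!%:R * (r%:R * err).
  move=> relw' mw' szw' ww' o0 o1; apply: IH => // p pw.
    have /q0 : p \in labelings (side0 w).
      apply/labelingsP => b y /mapP[c /ww' cw' [-> ->]].
      by move/labelingsP: pw; apply; apply/mapP; exists c.
    by rewrite /= ltnS o0.
  have /q1 : p \in labelings (side1 w).
    apply/labelingsP => b y /mapP[c /ww' cw' [-> ->]].
    by move/labelingsP: pw; apply; apply/mapP; exists c.
  by rewrite /= ltnS o1.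
have := rel_step i relw axw.
case E0: (loc0 x0 i) => [[u y0]|]; case E1: (loc1 x1 i) => [[v y1]|] //; last first.
  move=> _.
  have o0 : {in labelings (side0 w), forall p, oracle_of loc0 p a i = None}.
    by move=> p pw; rewrite /oracle_of (pos0 p pw) E0.
  have o1 : {in labelings (side1 w), forall p, oracle_of loc1 p a i = None}.
    by move=> p pw; rewrite /oracle_of (pos1 p pw) E1.
  rewrite (tot0 _ _ o0) (tot1 _ _ o1); apply: same => //; last lia.
  exact: rel_mono.
case=> uv; rewrite -{v}uv in E1; case=> [[b bw] | [y0w y1w rel_b]].
  have o0 : {in labelings (side0 w),
      forall p, oracle_of loc0 p a i = Some (mk u a b)}.
    move=> p pw; rewrite /oracle_of (pos0 p pw) E0 /=; congr (Some (mk _ _ _)).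
    apply: (@perm_inj _ p); rewrite permKV; apply/esym.
    by move/labelingsP: pw; apply; apply/mapP; exists (b, (y0, y1)).
  have o1 : {in labelings (side1 w),
      forall p, oracle_of loc1 p a i = Some (mk u a b)}.
    move=> p pw; rewrite /oracle_of (pos1 p pw) E1 /=; congr (Some (mk _ _ _)).
    apply: (@perm_inj _ p); rewrite permKV; apply/esym.
    by move/labelingsP: pw; apply; apply/mapP; exists (b, (y0, y1)).
  rewrite (tot0 _ _ o0) (tot1 _ _ o1); apply: same => //; last lia.
  exact: rel_mono.
rewrite /total (sum_labelings_label _ y0w) (sum_labelings_label _ y1w).
have side1E : unzip1 (side1 w) = unzip1 (side0 w) by rewrite /unzip1 -!map_comp.
rewrite side1E -sumrB; apply: le_trans (ler_norm_sum _ _ _) _.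
have szn : (size w < n)%N by lia.
have -> : (n - size w)`!%:R * (r%:R * err) =
    \sum_(b | b \notin unzip1 (side0 w)) (n - (size w).+1)`!%:R * (r%:R * err) :> R.
  rewrite sumr_const card_notin; last by case/andP: mw => /andP[].
  rewrite !size_map -[RHS]mulr_natl [RHS]mulrA -natrM subnS.
  rewrite -{1}(ltn_predK (_ : 0 < n - size w)%N) ?subn_gt0 // factS.
  by rewrite (ltn_predK (_ : 0 < n - size w)%N) ?subn_gt0.
apply: ler_sum => b bw.
have o0 : {in labelings (side0 ((b, (y0, y1)) :: w)),
    forall p, oracle_of loc0 p a i = Some (mk u a b)}.
  move=> p; rewrite labelings_cons => /andP[/eqP /= pb pw].
  by rewrite /oracle_of (pos0 p pw) E0 /= -pb permK.
have o1 : {in labelings (side1 ((b, (y0, y1)) :: w)),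
    forall p, oracle_of loc1 p a i = Some (mk u a b)}.
  move=> p; rewrite labelings_cons => /andP[/eqP /= pb pw].
  by rewrite /oracle_of (pos1 p pw) E1 /= -pb permK.
set w' := (b, (y0, y1)) :: w in o0 o1.
rewrite -[leLHS]/(`|total loc0 (side0 w') (Query a i next)
                    - total loc1 (side1 w') (Query a i next)|).
rewrite (tot0 _ _ o0) (tot1 _ _ o1); apply: (same _ w' (rel_b b)) => //.
- by rewrite joint_matching_cons mw bw y0w.
- by move=> c cw; rewrite inE cw orbT.
Qed.

Lemma coupled_all t : coupled t.
Proof.
elim: t => [b | p p01 t IHt u IHu | a i next IH] r w relw mw szw q0 q1.
- rewrite /total /= !sumr_const.
  case/andP: (mw) => /card_labelings -> /card_labelings ->.
  rewrite !size_map subrr normr0 mulr_ge0 ?ler0n // mulr_ge0 ?ler0n //.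
  exact: err_ge0.
- have /andP[p0 p1] := p01.
  have qt0 : within loc0 (side0 w) r t.
    by move=> s sw; apply: leq_trans (q0 s sw); apply: leq_maxl.
  have qu0 : within loc0 (side0 w) r u.
    by move=> s sw; apply: leq_trans (q0 s sw); apply: leq_maxr.
  have qt1 : within loc1 (side1 w) r t.
    by move=> s sw; apply: leq_trans (q1 s sw); apply: leq_maxl.
  have qu1 : within loc1 (side1 w) r u.
    by move=> s sw; apply: leq_trans (q1 s sw); apply: leq_maxr.
  have flipE loc l : total loc l (Flip p01 t u) =
      p * total loc l t + (1 - p) * total loc l u.
    by rewrite /total !mulr_sumr -big_split.
  rewrite !flipE.
  have := IHt r w relw mw szw qt0 qt1; have := IHu r w relw mw szw qu0 qu1.
  set c := _ * (r%:R * _); set t0 := total _ _ t; set t1 := total _ _ t.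
  set u0 := total _ _ u; set u1 := total _ _ u => hu ht.
  have -> : p * t0 + (1 - p) * u0 - (p * t1 + (1 - p) * u1) =
    p * (t0 - t1) + (1 - p) * (u0 - u1) by ring.
  apply: le_trans (ler_normD _ _) _; rewrite !normrM (ger0_norm p0).
  have p1' : 0 <= 1 - p by rewrite subr_ge0.
  rewrite (ger0_norm p1'); have := ler_wpM2l p0 ht; have := ler_wpM2l p1' hu; lra.
- case: r relw szw q0 q1 => [|r] relw szw q0 q1.
    by case/andP: mw => /labelings_n0[s /q0].
  have err0 := err_ge0; set fc := (n - size w)`!.
  have [aw | aw] := boolP (a \in unzip1 (side0 w)).
    apply: le_trans (coupled_known IH relw mw _ aw q0 q1) _; first by lia.
    by rewrite ler_wpM2l ?ler0n // ler_wpM2r // ler_nat.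
  have szM : (size w < M)%N by lia.
  have [bad0 [bad1 [le0 le1 good]]] := rel_fresh a relw (ltnW szM).
  have side1E : unzip1 (side1 w) = unzip1 (side0 w) by rewrite /unzip1 -!map_comp.
  rewrite /total (sum_labelings_position _ aw).
  rewrite [X in _ - X](@sum_labelings_position _ _ _ _ a) ?side1E //.
  set P0 := unzip2 (side0 w); set P1 := unzip2 (side1 w).
  have [uP0 uP1] : uniq P0 /\ uniq P1 by case/andP: mw => /andP[_ ?] /andP[_ ?].
  set U0 := fun x => total loc0 ((a, x) :: side0 w) (Query a i next).
  set U1 := fun x => total loc1 ((a, x) :: side1 w) (Query a i next).
  rewrite -[X in `|X - _|]/(\sum_(x | x \notin P0) U0 x).
  rewrite -[X in `|_ - X|]/(\sum_(x | x \notin P1) U1 x).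
  set k := (n - size w)%N; have k0 : (0 < k)%N by rewrite /k; lia.
  have kR : 0 < k%:R :> R by rewrite ltr0n.
  have cP0 : #|[pred x | x \notin P0]| = k by rewrite card_notin // !size_map.
  have cP1 : #|[pred x | x \notin P1]| = k by rewrite card_notin // !size_map.
  have fcE : fc = (k * (n - (size w).+1)`!)%N.
    by rewrite /fc -/k -(ltn_predK k0) factS (ltn_predK k0) subnS.
  set f1 := (n - (size w).+1)`! in fcE.
  (* The two positions of the fresh label are coupled independently: multiplying by k turns the
     difference into a sum over all pairs. Good pairs fall under [coupled_known], the others cost at
     most f1 each, and at most 2 * beta * k of the k^2 pairs are bad. *)
  have pairE : k%:R * (\sum_(x | x \notin P0) U0 x - \sum_(x | x \notin P1) U1 x) =
      \sum_(x0 | x0 \notin P0) \sum_(x1 | x1 \notin P1) (U0 x0 - U1 x1).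
    rewrite mulrBr mulr_sumr; under [RHS]eq_bigr => x0 _ do rewrite sumrB.
    rewrite sumrB; congr (_ - _).
      by apply: eq_bigr => x0 _; rewrite sumr_const cP1 mulr_natl.
    by rewrite sumr_const cP0 mulr_natl.
  rewrite -(ler_pM2l kR) -{1}(gtr0_norm kR) -normrM pairE.
  apply: le_trans (ler_norm_sum _ _ _) _.
  have term x0 x1 : x0 \notin P0 -> x1 \notin P1 -> `|U0 x0 - U1 x1| <=
      f1%:R * (r%:R * err) + (x0 \in bad0)%:R * f1%:R + (x1 \in bad1)%:R * f1%:R.
    move=> x0P x1P; have mw' : joint_matching ((a, (x0, x1)) :: w).
      by rewrite joint_matching_cons mw aw x0P.
    have base : 0 <= f1%:R * (r%:R * err).
      by rewrite mulr_ge0 ?ler0n // mulr_ge0 ?ler0n.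
    have f1_ge0 : 0 <= f1%:R :> R by rewrite ler0n.
    have [m0 m1] : matching ((a, x0) :: side0 w) /\ matching ((a, x1) :: side1 w).
      by case/andP: mw'.
    have crude : `|U0 x0 - U1 x1| <= f1%:R.
      have := total_ge0 loc0 ((a, x0) :: side0 w) (Query a i next).
      have := total_ge0 loc1 ((a, x1) :: side1 w) (Query a i next).
      have := total_le loc0 (Query a i next) m0.
      have := total_le loc1 (Query a i next) m1.
      rewrite /= !size_map -/f1 -/(U0 x0) -/(U1 x1) ler_norml => *.
      by apply/andP; split; lra.
    have [b0 | g0] := boolP (x0 \in bad0).
      by case: (x1 \in bad1); rewrite /=; lra.
    have [b1 | g1] := boolP (x1 \in bad1); first by rewrite /=; lra.
    rewrite !mul0r !addr0.
    have sz' : (size ((a, (x0, x1)) :: w) + 2 * r < M)%N.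
      by clear -szw; rewrite [size _]/=; lia.
    have aw' : a \in unzip1 (side0 ((a, (x0, x1)) :: w)) by rewrite mem_head.
    set w' := (a, (x0, x1)) :: w in mw' sz' aw' *.
    have q0' : within loc0 (side0 w') r.+1 (Query a i next).
      exact (@within_cons _ (a, x0) _ _ _ q0).
    have q1' : within loc1 (side1 w') r.+1 (Query a i next).
      exact (@within_cons _ (a, x1) _ _ _ q1).
    exact: (coupled_known IH (good _ _ g0 g1) mw' sz' aw' q0' q1').
  have sum_bad (P : seq 'I_n) (bad : {set 'I_n}) : (#|bad| <= beta)%N ->
      \sum_(x | x \notin P) (x \in bad)%:R * f1%:R <= (beta * f1)%:R :> R.
    move=> le; rewrite -mulr_suml natrM ler_wpM2r ?ler0n //.
    apply: (@le_trans _ _ #|bad|%:R); last by rewrite ler_nat.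
    rewrite -sum1_card natr_sum [leRHS]big_mkcond [leLHS]big_mkcond /=.
    by apply: ler_sum => x _; case: (x \in bad); case: (x \notin P).
  apply: (@le_trans _ _ (\sum_(x0 | x0 \notin P0) \sum_(x1 | x1 \notin P1)
     (f1%:R * (r%:R * err) + (x0 \in bad0)%:R * f1%:R + (x1 \in bad1)%:R * f1%:R))).
    apply: ler_sum => x0 x0P; apply: le_trans (ler_norm_sum _ _ _) _.
    by apply: ler_sum => x1 x1P; apply: term.
  apply: (@le_trans _ _ (\sum_(x0 | x0 \notin P0)
     (k%:R * (f1%:R * (r%:R * err)) + k%:R * ((x0 \in bad0)%:R * f1%:R)
      + (beta * f1)%:R))).
    apply: ler_sum => x0 _; rewrite !big_split /= !sumr_const cP1 !mulr_natl.
    by rewrite lerD2l sum_bad.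
  have const_sum (c : R) : \sum_(x | x \notin P0) c = k%:R * c.
    by rewrite sumr_const cP0 mulr_natl.
  rewrite !big_split /= !const_sum -mulr_sumr.
  have := sum_bad P0 _ le0.
  move=> /(ler_wpM2l (ltW kR)) sb0; rewrite fcE natrM.
  have errk : (2 * beta)%:R <= k%:R * err.
    rewrite /err mulrCA ler_peMr ?ler0n // ler_pdivlMr ?ltr0n ?subn_gt0 // mul1r.
    by rewrite ler_nat leq_sub2l // ltnW.
  have : f1%:R * (2 * beta)%:R <= f1%:R * (k%:R * err) :> R.
    by rewrite ler_wpM2l ?ler0n.
  move=> /(ler_wpM2l (ltW kR)).
  have -> : r.+1%:R = r%:R + 1 :> R by rewrite -natr1.
  move: sb0; rewrite !natrM; lra.
Qed.

End Coupling.

(** * Local answers and similarity *)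

Section LocalAnswers.
Variables (S : finType) (inv : S -> S).
Local Notation tag := (S * bool)%type.

(* The flag of a tag tells whether the queried element is the first or the
   second component of the tuple. *)
Definition tag_fact n (u : tag) (a b : 'I_n) : fact (bin_sig S) 'I_n :=
  existT (fun r : bin_sig S => (ar r).-tuple 'I_n) u.1
    (if u.2 then [tuple a; b] else [tuple b; a]).

Definition tag_sym (u : tag) : S := if u.2 then u.1 else inv u.1.

Variables (gT : finGroupType) (Z : finType) (to : {action gT &-> Z}).
Variable psi : S -> gT.
Hypothesis psiV : forall s, psi (inv s) = (psi s)^-1%g.
Variables (n : nat) (j : 'I_n -> Z).
Hypothesis j_inj : injective j.

Definition target (u : tag) (x : 'I_n) : Z := to (j x) (psi (tag_sym u)).

(* A loop is listed only once, with flag true. *)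
Definition live (u : tag) (x : 'I_n) : bool :=
  (target u x \in codom j) && (u.2 || (target u x != j x)).

(** The enumeration of tags is common to all structures, so positions with the same live tags list
    their tuples in the same order. *)
Definition live_tags x := [seq u <- enum {: tag} | live u x].

Definition nbr (u : tag) (x : 'I_n) : 'I_n := odflt x [pick y | j y == target u x].

Definition local_answer (d : nat) (x : 'I_n) (i : 'I_d) : option (tag * 'I_n) :=
  omap (fun u => (u, nbr u x)) (onth (live_tags x) i).

Lemma nbrE u x : target u x \in codom j -> j (nbr u x) = target u x.
Proof.
case/codomP => y yE; rewrite /nbr; case: pickP => [z /eqP // | /(_ y)].
by rewrite yE eqxx.
Qed.

Variable p : {perm 'I_n}.

Definition incident_list (a : 'I_n) : seq (fact (bin_sig S) 'I_n) :=
  [seq tag_fact u a ((p^-1)%g (nbr u (p a))) | u <- live_tags (p a)].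

Local Notation A := (point_structure to psi (fun a => j (p a))).

(** A tuple at a has one tag for each component equal to a; only a loop has two, and [live] keeps
    the one with flag true. This gives both completeness and absence of repetitions. *)
Lemma incident_list_perm a : perm_eq (incident_list a) (enum (incident A a)).
Proof.
apply: uniq_perm; last 1 first.
- case=> s t; rewrite mem_enum inE /=.
  have [x [y tE]] : exists x y, t = [tuple x; y].
    case/tupleP: (t) => x t'; case/tupleP: t' => y t'.
    by exists x, y; apply: val_inj; rewrite /= (tuple0 t').
  rewrite {t}tE; have := pair_rel_point to psi (fun a => j (p a)) s x y.
  rewrite /pair_rel => ->; rewrite !inE.
  apply/mapP/andP => [[[s' b]] | [/eqP xyE /orP[/eqP ax | /eqP ay]]].
  + rewrite mem_filter /live => /andP[/andP[tc _] _] E.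
    have ss' : s = s' by case: E.
    move: tc E; rewrite -{s'}ss' /tag_fact /= => tc /eqP; rewrite eq_Tagged /=.
    have := nbrE tc; set z := nbr _ _; rewrite /target /tag_sym.
    case: b {tc} @z => /= jz /eqP [-> ->]; rewrite eqxx ?orbT ?permKV jz.
      by [].
    by rewrite psiV actKV.
  + exists (s, true).
      rewrite mem_filter mem_enum andbT /live /= andbT /target /tag_sym /= ax xyE.
      exact: codom_f.
    rewrite /tag_fact /=; congr (existT _ _ _); rewrite -ax; congr [tuple _; _].
    apply: (@perm_inj _ p); rewrite permKV; apply: j_inj; rewrite nbrE.
      by rewrite /target /tag_sym /= ax xyE.
    by rewrite /target /tag_sym /= ax xyE codom_f.
  + have tE : target (s, false) (p a) = j (p x).
      by rewrite /target /tag_sym /= psiV ay -xyE actK.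
    have [xa | xa] := eqVneq x a.
      exists (s, true).
        rewrite mem_filter mem_enum andbT /live /= andbT /target /tag_sym /=.
        by rewrite -xa xyE codom_f.
      rewrite /tag_fact /=; congr (existT _ _ _); rewrite xa; congr [tuple _; _].
      apply: (@perm_inj _ p); rewrite permKV; apply: j_inj; rewrite nbrE.
        by rewrite /target /tag_sym /= -xa xyE.
      by rewrite /target /tag_sym /= -xa xyE codom_f.
    exists (s, false).
      rewrite mem_filter mem_enum andbT /live /= tE codom_f /=.
      by rewrite (inj_eq j_inj) (inj_eq perm_inj).
    rewrite /tag_fact /=; congr (existT _ _ _); rewrite -ay; congr [tuple _; _].
    apply: (@perm_inj _ p); rewrite permKV; apply: j_inj.
    by rewrite nbrE tE ?codom_f.
- have tags_uniq : uniq (live_tags (p a)) by apply/filter_uniq/enum_uniq.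
  rewrite map_inj_in_uniq // => -[s b] [s' b'].
  rewrite !mem_filter => /andP[/andP[tc l] _] /andP[/andP[tc' l'] _] E.
  have ss' : s = s' by case: E.
  move: tc' l' E; rewrite -{s'}ss' /tag_fact /= => tc' l' /eqP.
  rewrite eq_Tagged /=.
  have := nbrE tc; have := nbrE tc'.
  case: b b' tc tc' l l' => [] [] //= tc tc' l l' jz' jz /eqP [] //.
    move=> aE _; case/eqP: l'; rewrite -jz'; congr j; apply/esym.
    by move/(congr1 p): aE; rewrite permKV.
  move=> aE _; case/eqP: l; rewrite -jz; congr j.
  by move/(congr1 p): aE; rewrite permKV.
- exact: enum_uniq.
Qed.

Lemma point_degree_le : degree_le #|{: tag}| A.
Proof.
apply/forallP => a; rewrite /degree cardE -(perm_size (incident_list_perm a)).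
by rewrite size_map size_filter cardE count_size.
Qed.

Lemma point_oracle_for d :
  oracle_for A (oracle_of (@tag_fact n) (@local_answer d) p).
Proof.
exists incident_list; split=> [a | a i]; first exact: incident_list_perm.
rewrite /oracle_of /local_answer /incident_list onth_map.
by case: onth.
Qed.

End LocalAnswers.

Lemma card_bigcup_le (I T : finType) (B : I -> {set T}) (c : nat) :
  (forall i, #|B i| <= c)%N -> (#|\bigcup_i B i| <= #|I| * c)%N.
Proof.
move=> Bc; apply: (@leq_trans (\sum_i #|B i|)).
  apply: (big_ind2 (fun (A : {set T}) m => (#|A| <= m)%N)) => //.
    by rewrite cards0.
  move=> A1 m1 A2 m2 h1 h2; apply: leq_trans (leq_add h1 h2).
  exact: leq_card_setU.
by apply: leq_trans (leq_sum _ (fun i _ => Bc i)) _; rewrite sum_nat_const.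
Qed.

Lemma card_preim_inj (T U : finType) (g : T -> U) (E : {set U}) :
  injective g -> (#|[set x | g x \in E]| <= #|E|)%N.
Proof.
move=> g_inj; rewrite -(card_imset _ g_inj); apply/subset_leq_card/subsetP.
by move=> _ /imsetP[x + ->]; rewrite inE.
Qed.

Definition word_val (S : Type) (gT : finGroupType) (psi : S -> gT) (u : seq S) :
  gT := (\prod_(s <- u) psi s)%g.

Section NearPoints.
Variables (S : finType) (gT : finGroupType) (Z : finType).
Variables (to : {action gT &-> Z}) (psi : S -> gT) (n : nat) (j : 'I_n -> Z).
Hypothesis j_inj : injective j.
Variable q : nat.

(* Positions from which a word of length at most q leaves the labelled part, or
   that are joined to one of the positions in s by such a word. *)
Definition near (s : seq 'I_n) : {set 'I_n} :=
  \bigcup_(u : q.-bseq S)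
    ([set x | to (j x) (word_val psi u)
        \in ~: [set j y | y : 'I_n] :|: [set j y | y in s]]
     :|: [set x | j x \in [set to (j y) (word_val psi u) | y in s]]).

Lemma near_notin s x u : x \notin near s -> (size u <= q)%N ->
  [/\ to (j x) (word_val psi u) \in codom j,
      forall y, y \in s -> to (j x) (word_val psi u) != j y
    & forall y, y \in s -> to (j y) (word_val psi u) != j x].
Proof.
move=> xn szu; have : x \notin [set x | to (j x) (word_val psi u)
    \in ~: [set j y | y : 'I_n] :|: [set j y | y in s]]
   :|: [set x | j x \in [set to (j y) (word_val psi u) | y in s]].
  by apply: contra xn => xu; apply/bigcupP; exists (Bseq szu).
rewrite !inE negb_or => /andP[/norP[/negbNE /imsetP[y _ yE] h1] h2].
split; first by rewrite yE codom_f.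
  by move=> z zs; apply: contra h1 => /eqP ->; apply: imset_f.
by move=> z zs; apply: contra h2 => /eqP <-; apply/imsetP; exists z.
Qed.

(** Each word acts injectively: at most D positions are sent outside the labelled part, at most
    [size s] into s, and at most [size s] are reached from s. *)
Lemma card_near s D : (#|Z| <= n + D)%N ->
  (#|near s| <= #|{: q.-bseq S}| * (D + 2 * size s))%N.
Proof.
move=> ZD; apply: card_bigcup_le => u.
have s_le (U : finType) (g : 'I_n -> U) : (#|[set g y | y in s]| <= size s)%N.
  by apply: leq_trans (leq_imset_card _ _) (card_size _).
apply: leq_trans (leq_card_setU _ _) _; rewrite mul2n -addnn addnA leq_add //.
  have inj : injective (fun x => to (j x) (word_val psi u)).
    by move=> x y /act_inj /j_inj.
  apply: leq_trans (card_preim_inj _ inj) _.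
  apply: leq_trans (leq_card_setU _ _) _; rewrite leq_add //.
  by rewrite cardsCs setCK card_imset // card_ord leq_subLR.
exact: leq_trans (card_preim_inj _ j_inj) _.
Qed.

End NearPoints.

Section Simulation.
Variables (S : finType) (inv : S -> S) (n : nat).
Variables (gT0 : finGroupType) (Z0 : finType) (to0 : {action gT0 &-> Z0}).
Variables (psi0 : S -> gT0) (j0 : 'I_n -> Z0).
Variables (gT1 : finGroupType) (Z1 : finType) (to1 : {action gT1 &-> Z1}).
Variables (psi1 : S -> gT1) (j1 : 'I_n -> Z1).
Hypotheses (psiV0 : forall s, psi0 (inv s) = (psi0 s)^-1%g)
           (psiV1 : forall s, psi1 (inv s) = (psi1 s)^-1%g).
Hypotheses (j0_inj : injective j0) (j1_inj : injective j1).
Variables (q D : nat).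
Hypotheses (D0 : (#|Z0| <= n + D)%N) (D1 : (#|Z1| <= n + D)%N).
Hypothesis same_ball : forall (u : seq S) x0 x1, (size u <= q)%N ->
  (to0 x0 (word_val psi0 u) == x0) = (to1 x1 (word_val psi1 u) == x1).

Local Notation state := (seq ('I_n * ('I_n * 'I_n))).
Implicit Types w : state.

(** The instance of [rel] for the coupling; r is the radius up to which words from placed positions
    are controlled. *)
Definition similar r w : Prop :=
  [/\ (r <= q)%N,
      forall a x0 x1 u, (a, (x0, x1)) \in w -> (size u <= r)%N ->
        to0 (j0 x0) (word_val psi0 u) \in codom j0 /\
        to1 (j1 x1) (word_val psi1 u) \in codom j1
    & forall a x0 x1 b y0 y1 u, (a, (x0, x1)) \in w -> (b, (y0, y1)) \in w ->
        (size u <= r)%N ->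
        (to0 (j0 x0) (word_val psi0 u) == j0 y0) =
        (to1 (j1 x1) (word_val psi1 u) == j1 y1)].

Lemma similar_nil : similar q [::].
Proof. by split. Qed.

Lemma similar_mono r w : similar r.+1 w -> similar r w.
Proof.
case=> rq cod eqv; split; first exact: ltnW.
  by move=> a x0 x1 u aw ur; apply: cod aw (leqW ur).
by move=> a x0 x1 b y0 y1 u aw bw ur; apply: eqv aw bw (leqW ur).
Qed.

Local Notation loc0 := (@local_answer S inv gT0 Z0 to0 psi0 n j0 _).
Local Notation loc1 := (@local_answer S inv gT1 Z1 to1 psi1 n j1 _).

Lemma word_val_cons (gT : finGroupType) (psi : S -> gT) s u :
  word_val psi (s :: u) = (psi s * word_val psi u)%g.
Proof. by rewrite /word_val big_cons. Qed.

Lemma word_val_rcons (gT : finGroupType) (psi : S -> gT) s u :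
  word_val psi (rcons u s) = (word_val psi u * psi s)%g.
Proof. by rewrite /word_val -cats1 big_cat big_seq1. Qed.

Lemma word_val1 (gT : finGroupType) (psi : S -> gT) s :
  word_val psi [:: s] = psi s.
Proof. by rewrite /word_val big_seq1. Qed.

(** A word leaving the new point is a word leaving the old one with s in front; a word arriving
    there arrives at the old one after appending [inv s]. Either way one letter of radius is
    used. *)
Lemma similar_extend r w a x0 x1 s y0 y1 b :
  similar r.+1 w -> (a, (x0, x1)) \in w ->
  j0 y0 = to0 (j0 x0) (psi0 s) -> j1 y1 = to1 (j1 x1) (psi1 s) ->
  similar r ((b, (y0, y1)) :: w).
Proof.
move=> [rq cod eqv] aw y0E y1E.
have step0 u : to0 (j0 y0) (word_val psi0 u) = to0 (j0 x0) (word_val psi0 (s :: u)).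
  by rewrite y0E word_val_cons actM.
have step1 u : to1 (j1 y1) (word_val psi1 u) = to1 (j1 x1) (word_val psi1 (s :: u)).
  by rewrite y1E word_val_cons actM.
have back0 z u : (to0 z (word_val psi0 u) == j0 y0) =
    (to0 z (word_val psi0 (rcons u (inv s))) == j0 x0).
  rewrite word_val_rcons psiV0 actM y0E.
  by rewrite -(inj_eq (act_inj to0 (psi0 s)^-1%g)) actK.
have back1 z u : (to1 z (word_val psi1 u) == j1 y1) =
    (to1 z (word_val psi1 (rcons u (inv s))) == j1 x1).
  rewrite word_val_rcons psiV1 actM y1E.
  by rewrite -(inj_eq (act_inj to1 (psi1 s)^-1%g)) actK.
split; first exact: ltnW.
  move=> c z0 z1 u; rewrite inE => /predU1P[[_ -> ->] | cw] ur.
    by rewrite step0 step1; apply: cod aw _.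
  exact: cod cw (leqW ur).
move=> c z0 z1 c' z0' z1' u; rewrite !inE.
move=> /predU1P[[_ -> ->] | cw] /predU1P[[_ -> ->] | cw'] ur.
- by apply: same_ball; apply: leq_trans ur (ltnW rq).
- by rewrite step0 step1; apply: eqv aw cw' _.
- by rewrite back0 back1; apply: eqv cw aw _; rewrite size_rcons.
- exact: eqv cw cw' (leqW ur).
Qed.

Lemma similar_step d r w a x0 x1 (i : 'I_d) :
  similar r.+1 w -> (a, (x0, x1)) \in w ->
  match loc0 x0 i, loc1 x1 i with
  | None, None => True
  | Some (u, y0), Some (v, y1) => u = v /\
     ((exists b, (b, (y0, y1)) \in w) \/
      [/\ y0 \notin unzip2 (side0 w), y1 \notin unzip2 (side1 w)
        & forall b, similar r ((b, (y0, y1)) :: w)])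
  | _, _ => False
  end.
Proof.
move=> sim aw; have [rq cod eqv] := sim.
have tc u : target inv to0 psi0 j0 u x0 \in codom j0 /\
            target inv to1 psi1 j1 u x1 \in codom j1.
  have := cod _ _ _ [:: tag_sym inv u] aw isT; rewrite !word_val1.
  exact.
have tagsE : live_tags inv to0 psi0 j0 x0 = live_tags inv to1 psi1 j1 x1.
  apply: eq_filter => u; rewrite /live (tc u).1 (tc u).2 /=; congr (_ || ~~ _).
  by have := eqv _ _ _ _ _ _ [:: tag_sym inv u] aw aw isT; rewrite !word_val1.
rewrite /local_answer -tagsE; case: onth => [u|] //=; split=> //.
set y0 := nbr _ _ _ _ _ _; set y1 := nbr _ _ _ _ _ _.
have y0E : j0 y0 = to0 (j0 x0) (psi0 (tag_sym inv u)) by apply: nbrE (tc u).1.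
have y1E : j1 y1 = to1 (j1 x1) (psi1 (tag_sym inv u)) by apply: nbrE (tc u).2.
have eqvu b z0 z1 : (b, (z0, z1)) \in w -> (y0 == z0) = (y1 == z1).
  move=> bw; have := eqv _ _ _ _ _ _ [:: tag_sym inv u] aw bw isT.
  by rewrite !word_val1 -y0E -y1E (inj_eq j0_inj) (inj_eq j1_inj).
have [/mapP[[b z0] /mapP[[c [z0' z1]] cw [-> ->]] /= y0z] | y0n] :=
  boolP (y0 \in unzip2 (side0 w)).
  left; exists c; have := eqvu _ _ _ cw; rewrite -y0z eqxx => /esym/eqP ->.
  by rewrite y0z.
right; split=> //; last by move=> b; apply: similar_extend sim aw y0E y1E.
apply: contra y0n => /mapP[[b z1] /mapP[[c [z0 z1']] cw [-> ->]] /= y1z].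
have := eqvu _ _ _ cw; rewrite -y1z eqxx => /eqP ->.
by apply/mapP; exists (c, z0) => //; apply/mapP; exists (c, (z0, z1')).
Qed.

(** Outside [near] no short word joins the new position to an old one, on either side, so the
    required equivalences hold because both members are false. *)
Lemma similar_fresh r w a M : similar r w -> (size w <= M)%N ->
  exists bad0 bad1 : {set 'I_n},
    [/\ (#|bad0| <= #|{: q.-bseq S}| * (D + 2 * M))%N,
        (#|bad1| <= #|{: q.-bseq S}| * (D + 2 * M))%N
      & forall x0 x1, x0 \notin bad0 -> x1 \notin bad1 ->
          similar r ((a, (x0, x1)) :: w)].
Proof.
move=> [rq cod eqv] szw.
exists (near to0 psi0 j0 q (unzip2 (side0 w))),
  (near to1 psi1 j1 q (unzip2 (side1 w))).
have mono (s : seq 'I_n) : size s = size w ->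
    (#|{: q.-bseq S}| * (D + 2 * size s) <= #|{: q.-bseq S}| * (D + 2 * M))%N.
  by move=> ->; rewrite leq_mul2l leq_add2l leq_mul2l szw !orbT.
split.
- by apply: leq_trans (card_near _ _ j0_inj _ _ D0) (mono _ _); rewrite !size_map.
- by apply: leq_trans (card_near _ _ j1_inj _ _ D1) (mono _ _); rewrite !size_map.
move=> x0 x1 n0 n1.
have P0 c z0 z1 : (c, (z0, z1)) \in w -> z0 \in unzip2 (side0 w).
  by move=> cw; apply/mapP; exists (c, z0) => //; apply/mapP; exists (c, (z0, z1)).
have P1 c z0 z1 : (c, (z0, z1)) \in w -> z1 \in unzip2 (side1 w).
  by move=> cw; apply/mapP; exists (c, z1) => //; apply/mapP; exists (c, (z0, z1)).
split=> //.
  move=> c z0 z1 u; rewrite inE => /predU1P[[_ -> ->] | cw] ur; last first.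
    exact: cod cw ur.
  have [c0 _ _] := near_notin n0 (leq_trans ur rq).
  by have [c1 _ _] := near_notin n1 (leq_trans ur rq).
move=> c z0 z1 c' z0' z1' u; rewrite !inE.
move=> /predU1P[[_ -> ->] | cw] /predU1P[[_ -> ->] | cw'] ur;
  have uq := leq_trans ur rq; have [_ f0 g0] := near_notin n0 uq;
  have [_ f1 g1] := near_notin n1 uq.
- exact: same_ball.
- by rewrite (negPf (f0 _ (P0 _ _ _ cw'))) (negPf (f1 _ (P1 _ _ _ cw'))).
- by rewrite (negPf (g0 _ (P0 _ _ _ cw))) (negPf (g1 _ (P1 _ _ _ cw))).
- exact: eqv cw cw' ur.
Qed.

Variable R : realType.

Lemma indistinguishable d (t : algorithm R (bin_sig S) d n) :
  (2 * q < n)%N ->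
  (forall p, num_queries (oracle_of (@tag_fact S n) loc0 p) t <= q)%N ->
  (forall p, num_queries (oracle_of (@tag_fact S n) loc1 p) t <= q)%N ->
  `|\sum_p output_prob (oracle_of (@tag_fact S n) loc0 p) true t -
    \sum_p output_prob (oracle_of (@tag_fact S n) loc1 p) true t| <=
  n`!%:R * (q%:R * err R n (2 * q) (#|{: q.-bseq S}| * (D + 2 * (2 * q)))).
Proof.
move=> qn q0 q1.
have := @coupled_all R (bin_sig S) d n _ (@tag_fact S n) loc0 loc1 similar (2 * q)
  (#|{: q.-bseq S}| * (D + 2 * (2 * q))) similar_mono (@similar_step d) _ qn t q [::]
  similar_nil isT.
rewrite subn0 => /(_ _ _ _ _) H.
have allE (f : {perm 'I_n} -> R) : \sum_(p in labelings [::]) f p = \sum_p f p.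
  by apply: eq_bigl => p; rewrite inE.
move: H; rewrite /total /= !allE; apply => //.
  by move=> r w a sim szw; apply: similar_fresh.
Qed.

End Simulation.

(** * Non-testability *)

(* Infinitely many quotients, finitely many balls of radius q. *)
Lemma same_ball_quotients (F : finFieldType) (q : nat) :
  exists (Q0 : finGroupType) (psi0 : sym F -> Q0), lawful psi0 /\
  forall m, exists (Q1 : finGroupType) (psi1 : sym F -> Q1),
    [/\ lawful psi1, root_group (fun i g => psi1 (i, g)) = [set: Q1] :> {set Q1},
        (m <= #|Q1|)%N
      & forall u, (size u <= q)%N ->
          (word_val psi0 u == 1%g) = (word_val psi1 u == 1%g)].
Proof.
pose ball (Q : finGroupType) (psi : sym F -> Q) : {set q.-bseq (sym F)} :=
  [set u | word_val psi (u : q.-bseq (sym F)) == 1%g].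
pose realized b m := exists (Q : finGroupType) (psi : sym F -> Q),
  [/\ lawful psi, root_group (fun i g => psi (i, g)) = [set: Q] :> {set Q},
      (m <= #|Q|)%N & ball Q psi = b].
(* If every ball b failed at some size m b, a quotient of size at least the sum of all m b would
   have no possible ball. *)
have [b bP] : exists b, forall m, realized b m.
  apply: contrapT => /forallNP none.
  have {none}none b : exists m, ~ realized b m by apply/existsNP/none.
  have [m mP] := fin_all_exists none.
  have [Q [psi [L G cQ]]] := unbounded_quotients F (\sum_b m b).
  apply: (mP (ball Q psi)); exists Q, psi; split=> //.
  by apply: leq_trans cQ; rewrite (bigD1 (ball Q psi)) //= leq_addr.
have [Q0 [psi0 [L0 _ _ b0]]] := bP 0%N; exists Q0, psi0; split=> // m.
have [Q1 [psi1 [L1 G1 c1 b1]]] := bP m; exists Q1, psi1; split=> // u szu.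
by have /setP/(_ (Bseq szu)) := etrans b0 (esym b1); rewrite !inE.
Qed.

Section Copies.
Variables (k : nat) (Q : finGroupType).

Definition copies_act (x : 'I_k * Q) (g : Q) : 'I_k * Q := (x.1, x.2 * g)%g.

Lemma copies_act1 : copies_act^~ 1%g =1 id.
Proof. by case=> c x; rewrite /copies_act mulg1. Qed.

Lemma copies_actM x : act_morph copies_act x.
Proof. by case: x => c x g h; rewrite /copies_act /= mulgA. Qed.

Definition copies_action := TotalAction copies_act1 copies_actM.

End Copies.

Lemma point_structure_models (F : finFieldType) (gT : finGroupType) (Z : finType)
    (to : {action gT &-> Z}) (psi : sym F -> gT) (T : finType) (j : T -> Z) :
  lawful psi -> bijective j ->
  models (point_structure to psi j) (action_sentence (sym_one F) (@sym_law F)).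
Proof.
move=> [psi1 psiM] [j' jK j'K]; apply/models_action_sentence; split.
- by move=> s x; exists (j' (to (j x) (psi s))); rewrite pair_rel_point j'K.
- move=> s t r x y z /psiM strE; rewrite !pair_rel_point => /eqP xy /eqP yz.
  by rewrite -strE actM xy yz.
- by move=> x y; rewrite pair_rel_point psi1 act1 (can_eq jK) => /eqP.
Qed.

Lemma far_lower_bound (R : realType) (sigma : signature) (d : nat)
    (P : property sigma d) (eps : R) n (A : structure sigma 'I_n) :
  (forall B, P n B -> eps < (sym_diff_card A B)%:R / (d * n)%:R) -> far P eps A.
Proof.
move=> lb; rewrite /far /dist; apply: (big_ind (fun x => eps%:E < x)%E).
- exact: ltry.
- by move=> x y ex ey; rewrite lt_min ex.
- by move=> B PB; rewrite lte_fin lb.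
Qed.

Section NotTestable.
Variables (R : realType) (F : finFieldType).
Hypothesis q_ge : 300 * 100 <= #|F|%:R :> R.
Local Notation d := #|{: sym F * bool}|.
Local Notation phi := (action_sentence (sym_one F) (@sym_law F)).

Lemma tags_card_gt0 : (0 < d)%N.
Proof. by apply/card_gt0P; exists (sym_one F, true). Qed.

(** The distance is normalised by d * n, so it is at least 1 / (888 * d); 1000 provides
    strictness. *)
Lemma point_structure_is_far (Q : finGroupType) (psi : sym F -> Q) n
    (j : 'I_n -> Q) :
  lawful psi -> root_group (fun i g => psi (i, g)) = [set: Q] :> {set Q} ->
  (0 < n < #|Q|)%N ->
  far (model_property d phi) ((1000 * d%:R)^-1 : R) (point_structure 'R psi j).
Proof.
move=> L G /andP[n0 nQ].
apply: far_lower_bound => B /andP[_ /models_action_sentence BL].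
have := point_structure_far j q_ge L G nQ BL.
set s := _%:R => le888; have d0 := tags_card_gt0.
have dR : 0 < d%:R :> R by rewrite ltr0n.
have nR : 0 < n%:R :> R by rewrite ltr0n.
rewrite natrM ltr_pdivlMr ?mulr_gt0 // mulrA -ltr_pdivlMr // invfM -mulrA.
rewrite [X in _ * X]mulVf ?gt_eqF // mulr1 ltr_pdivlMr //; lra.
Qed.

Lemma model_property_not_testable : ~ testable R (model_property d phi).
Proof.
case=> qq tester; have d0 := tags_card_gt0.
have dR : 1 <= d%:R :> R by rewrite ler1n.
set eps : R := (1000 * d%:R)^-1.
have eps01 : 0 < eps < 1.
  have d1000 : 1 < 1000 * d%:R :> R by lra.
  by rewrite /eps invr_gt0 invf_lt1 ?d1000 ?(lt_trans ltr01).
set q := qq eps.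
have [Q0 [psi0 [L0 quotients]]] := same_ball_quotients F q.
set c := #|Q0|; have c0 : (0 < c)%N by apply/card_gt0P; exists 1%g.
set beta := (#|{: q.-bseq (sym F)}| * (c + 2 * (2 * q)))%N.
(* As n >= |Q1| - c, this size gives n - 2 q > 6 q beta, so the total error 2 q beta / (n - 2 q) is
   below 1/3, the gap between the acceptance probabilities. *)
have [Q1 [psi1 [L1 G1 Q1_large ball_eq]]] :=
  quotients (c + 2 * q + 6 * (q * beta) + 1)%N.
(* The predecessor keeps k * c < |Q1| strict even if c divides |Q1|; at most c elements remain
   unlabelled. *)
pose k := (#|Q1|.-1 %/ c)%N.
set n := #|{: 'I_k * Q0}|.
have nE : n = (k * c)%N by rewrite /n card_prod card_ord.
have Q1_gt0 : (0 < #|Q1|)%N by apply: leq_trans Q1_large; rewrite addn1.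
have n_lt : (n < #|Q1|)%N.
  by rewrite nE -[ltnRHS](prednK Q1_gt0) ltnS leq_trunc_div.
have Q1_le : (#|Q1| <= n + c)%N.
  have := ltn_ceil #|Q1|.-1 c0; rewrite -/k mulSn -nE.
  by rewrite -[in X in _ -> X](prednK Q1_gt0) addnC.
have n_large : (2 * q + 6 * (q * beta) < n)%N by lia.
pose j0 (y : 'I_n) : 'I_k * Q0 := enum_val y.
pose j1 (y : 'I_n) : Q1 := enum_val (widen_ord (ltnW n_lt) y).
have j0_inj : injective j0 by apply: enum_val_inj.
have j1_inj : injective j1.
  by move=> x y /enum_val_inj /(congr1 val) /= xy; apply: val_inj.
have j0_bij : bijective j0 by apply: enum_val_bij.
have [t [tP tq]] := tester n eps eps01.
pose ans0 p := oracle_of (@tag_fact _ n)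
  (@local_answer _ (@sym_inv F) _ _ (copies_action k Q0) psi0 n j0 d) p.
pose ans1 p := oracle_of (@tag_fact _ n)
  (@local_answer _ (@sym_inv F) _ _ 'R psi1 n j1 d) p.
have deg0 p := point_degree_le (copies_action k Q0) (lawfulV L0) j0_inj p.
have deg1 p := point_degree_le 'R (lawfulV L1) j1_inj p.
have or0 p := point_oracle_for (copies_action k Q0) (lawfulV L0) j0_inj p d.
have or1 p := point_oracle_for 'R (lawfulV L1) j1_inj p d.
have yes p : 2 / 3 <= output_prob (ans0 p) true t.
  have [+ _] := tP _ _ (deg0 p) (or0 p); apply; rewrite /= deg0 /=.
  apply: point_structure_models => //; apply: bij_comp j0_bij _.
  exact: Bijective (permK p) (permKV p).
have no p : output_prob (ans1 p) true t <= 1 / 3.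
  have [_ /(_ _)] := tP _ _ (deg1 p) (or1 p).
  have := output_prob_compl (ans1 p) t; rewrite -/(ans1 p) => sum1 farP.
  suff /farP : far (model_property d phi) eps
      (point_structure 'R psi1 (fun a => j1 (p a))) by lra.
  by apply: point_structure_is_far => //; rewrite n_lt andbT; lia.
have := @indistinguishable (sym F) (@sym_inv F) n _ _ (copies_action k Q0) psi0 j0
  _ _ 'R psi1 j1 (lawfulV L0) (lawfulV L1) j0_inj j1_inj q c _ _ _ R d t _ _ _.
have -> : #|{: 'I_k * Q0}| = n by [].
move=> /(_ (leq_addr _ _) Q1_le) ind.
have {ind} := ind _ _ (fun p => tq _ _ (deg0 p) (or0 p))
  (fun p => tq _ _ (deg1 p) (or1 p)).
rewrite -/beta => ind.
have {ind} : n`!%:R * (1 / 3) <= n`!%:R * (q%:R * err R n (2 * q) beta) :> R.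
  apply: le_trans (ind _ _); last first.
  - by lia.
  - move=> u [e x0] x1 szu; rewrite /= /copies_act xpair_eqE eqxx /=.
    by rewrite -{2}[x0]mulg1 -{2}[x1]mulg1 !(inj_eq (mulgI _)) ball_eq.
  apply: le_trans (ler_norm _); rewrite -sumrB.
  apply: (@le_trans _ _ (\sum_(p : {perm 'I_n}) (1 / 3))).
    by rewrite sum_const_natl card_Sn.
  by apply: ler_sum => p _; have := yes p; have := no p; rewrite /ans0 /ans1; lra.
rewrite ler_pM2l ?ltr0n ?fact_gt0 // leNgt => /negP; apply.
rewrite /err mulrA ltr_pdivrMr ?ltr0n ?subn_gt0; last by lia.
have : (2 * q + 6 * (q * beta))%:R < n%:R :> R by rewrite ltr_nat.
rewrite natrB; last by lia.
rewrite !natrD !natrM; lra.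
Qed.

End NotTestable.

Theorem theorem4p7 (R : realType) :
  exists (d : nat) (sigma : signature) (phi : sentence sigma),
    Pi2 phi /\ ~ testable R (model_property d phi).
Proof.
have [p p_gt p_prime] := prime_above (Num.bound (300 * 100 : R)).
have q_ge : 300 * 100 <= #|'F_p|%:R :> R.
  rewrite card_Fp //; apply: ltW.
  apply: lt_trans (_ : _ < (Num.bound (300 * 100 : R))%:R) _.
    by apply: archi_boundP; lra.
  by rewrite ltr_nat.
exists #|{: sym 'F_p * bool}|, (bin_sig (sym 'F_p)),
  (action_sentence (sym_one 'F_p) (@sym_law 'F_p)).
split; first exact: action_sentence_Pi2.
exact: model_property_not_testable q_ge.
Qed.
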